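(* Let $A$ be a finite abelian group. The functor $\mathcal{F}:\mathrm{Rep}(\mathrm{ASp}(A))\to\mathrm{Rep}(C(A))$, equipped with the tensor structure $J$, is an isomorphism of tensor categories. Its inverse is the functor $\mathcal{F}^{-1}:\mathrm{Rep}(C(A))\to\mathrm{Rep}(\mathrm{ASp}(A))$, equipped with the tensor structure $K$. (The functors $\mathcal F,\mathcal F^{-1}$ and the maps $J,K$ are those explicitly defined in the context.)
   Context: **Setting.** $A$ is a finite abelian group, written additively; $\widehat{A}=\mathrm{Hom}(A,U(1))$ is its character group, written multiplicatively; $V_A=A\oplus\widehat{A}$ (written additively, so $(a,\chi)+(b,\psi)=(a+b,\chi\psi)$); $\widehat{V_A}=\mathrm{Hom}(V_A,U(1))$. Put $\beta_A((a,\chi),(b,\psi))=\chi(b)$ and $\omega_A(u,v)=\beta_A(u,v)\beta_A(v,u)^{-1}$. Then $\mathrm{Sp}(V_A)=\{T\in\mathrm{Aut}(V_A):\omega_A(Tu,Tv)=\omega_A(u,v)\ \forall u,v\in V_A\}$. **Projective Clifford group.** Let $\mathcal{H}=\mathbb{C}[A]$ with orthonormal basis $|b\rangle$, $b\in A$; for $v=(a,\chi)\in V_A$ let $W_v|b\rangle=\chi(b)|a+b\rangle$; $H(A)=\{zW_v:z\in U(1),v\in V_A\}$ and $C(A)=N_{U(\mathcal{H})}(H(A))/(U(1)\cdot I)$. Throughout, $C(A)$ is identified (by a known isomorphism) with the group of pairs $(T,\lambda)$, $T\in\mathrm{Aut}(V_A)$, $\lambda:V_A\to U(1)$ a function, satisfying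 $$\frac{\lambda(u+v)}{\lambda(u)\lambda(v)}=\frac{\beta_A(Tu,Tv)}{\beta_A(u,v)}\qquad\text{for all }u,v\in V_A,$$ with product $(T,\lambda)(S,\mu)=(TS,\lambda^S\mu)$, $\lambda^S(u)=\lambda(Su)$; the pair $(T,\lambda)$ corresponds to the class of any unitary $U$ with $UW_uU^\dagger=\lambda(u)W_{Tu}$ for all $u$. Necessarily $T\in\mathrm{Sp}(V_A)$ and $\lambda(0)=1$, and the projection $(T,\lambda)\mapsto T$ is onto $\mathrm{Sp}(V_A)$ (known). **Affine symplectic group.** $\mathrm{ASp}(A)=\mathrm{Sp}(V_A)\ltimes\widehat{V_A}=\{(T,\chi):T\in\mathrm{Sp}(V_A),\chi\in\widehat{V_A}\}$ with $(T,\chi)(S,\psi)=(TS,\chi^S\psi)$, $\chi^S(v)=\chi(Sv)$. **Categories.** $\mathrm{Rep}(G)$ is the tensor category of finite-dimensional complex representations of the finite group $G$. An isomorphism of tensor categories is a tensor functor having an inverse tensor functor, both composites being equal to the identity functor with identity tensor structure. **The functor $\mathcal{F}$.** For a representation $(U,\pi)$ of $\mathrm{ASp}(A)$ put $U_v=\{\xi\in U:\pi(\mathrm{id},\chi)\xi=\chi(v)\xi\ \forall\chi\in\widehat{V_A}\}$ for $v\in V_A$ and $\rho(T)=\pi(T,1)$. Then $U=\bigoplus_{v\in V_A}U_v$ and $\rho(T)U_v\subseteq U_{Tv}$. $\mathcal{F}(U)$ is the same vector space with the $C(A)$-action $(T,\lambda)\cdot\xi=\lambda(v)\rho(T)\xi$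 for $\xi\in U_v$; $\mathcal{F}$ is the identity on morphisms. Its tensor structure is $J_{U,W}:\mathcal{F}(U)\otimes\mathcal{F}(W)\to\mathcal{F}(U\otimes W)$, $J_{U,W}(\xi\otimes\eta)=\beta_A(v,w)\,\xi\otimes\eta$ for $\xi\in U_v$, $\eta\in W_w$, with identity unit map. **The functor $\mathcal{F}^{-1}$.** For $X\in\mathrm{Rep}(C(A))$ put $X_v=\{\xi\in X:(\mathrm{id},\chi)\cdot\xi=\chi(v)\xi\ \forall\chi\in\widehat{V_A}\}$, so $X=\bigoplus_{v\in V_A} X_v$, and set $\rho_X(T)|_{X_v}=\lambda(v)^{-1}(T,\lambda)|_{X_v}$ for any lift $(T,\lambda)\in C(A)$ of $T\in\mathrm{Sp}(V_A)$. $\mathcal{F}^{-1}(X)$ is the same graded vector space with $\mathrm{ASp}(A)$-action $(T,\chi)\cdot\xi=\chi(v)\rho_X(T)\xi$ for $\xi\in X_v$; $\mathcal{F}^{-1}$ is the identity on morphisms. Its tensor structure is $K_{X,Y}:\mathcal{F}^{-1}(X)\otimes\mathcal{F}^{-1}(Y)\to\mathcal{F}^{-1}(X\otimes Y)$, $K_{X,Y}(\xi\otimes\eta)=\beta_A(v,w)^{-1}\xi\otimes\eta$ for $\xi\in X_v$, $\eta\in Y_w$. *)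

(* Defs.v *)
From HB Require Import structures.
From mathcomp Require Import all_boot all_order all_algebra all_fingroup.
From mathcomp Require Import spectral boolp reals complex.

Set Implicit Arguments.
Unset Strict Implicit.
Unset Printing Implicit Defensive.

Import Order.TTheory GRing.Theory Num.Theory.
Local Open Scope ring_scope.

Section Dual.
Variables (C : numClosedFieldType) (B : finZmodType).

Definition is_char (chi : {ffun B -> C}) : bool :=
  [forall a, forall b, chi (a + b) == chi a * chi b] &&
  [forall a, `|chi a| == 1].

Record dual := Dual { dual_fun :> {ffun B -> C}; _ : is_char dual_fun }.

HB.instance Definition _ := [isSub for dual_fun].
HB.instance Definition _ := [Choice of dual by <:].

Lemma charD (chi : dual) a b : chi (a + b) = chi a * chi b.
Proof. by case: chi => f /= /andP[/forallP/(_ a)/forallP/(_ b)/eqP]. Qed.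

Lemma char_norm (chi : dual) a : `|chi a| = 1.
Proof. by case: chi => f /= /andP[_ /forallP/(_ a)/eqP]. Qed.

Lemma char_neq0 (chi : dual) a : chi a != 0.
Proof. by rewrite -normr_gt0 char_norm ltr01. Qed.

Lemma char0 (chi : dual) : chi 0 = 1.
Proof.
by apply: (mulfI (char_neq0 chi 0)); rewrite -charD addr0 mulr1.
Qed.

Lemma charN (chi : dual) a : chi (- a) = (chi a)^-1.
Proof.
apply: (mulfI (char_neq0 chi a)).
by rewrite -charD subrr char0 divff ?char_neq0.
Qed.

Lemma charMn (chi : dual) a n : chi (a *+ n) = chi a ^+ n.
Proof. by elim: n => [|n IH]; rewrite ?mulr0n ?char0 // mulrS charD IH exprS. Qed.

Lemma is_charP (f : {ffun B -> C}) :
  (forall a b, f (a + b) = f a * f b) -> (forall a, `|f a| = 1) -> is_char f.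
Proof.
move=> fD f1; apply/andP; split; last by apply/forallP => a; rewrite f1.
by apply/forallP => a; apply/forallP => b; rewrite fD.
Qed.

Fact dual_add_subproof (chi psi : dual) : is_char [ffun a => chi a * psi a].
Proof.
apply: is_charP => [a b|a]; rewrite !ffunE.
  by rewrite !charD mulrACA.
by rewrite normrM !char_norm mulr1.
Qed.
Fact dual_zero_subproof : is_char [ffun=> 1].
Proof. by apply: is_charP => [a b|a]; rewrite !ffunE ?mulr1 ?normr1. Qed.
Fact dual_opp_subproof (chi : dual) : is_char [ffun a => (chi a)^-1].
Proof.
apply: is_charP => [a b|a]; rewrite !ffunE.
  by rewrite charD invfM.
by rewrite normfV char_norm invr1.
Qed.

(* The group law of the dual is the pointwise product of characters; it is
   written additively, as in A (+) dual A. *)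
Definition dual_add (chi psi : dual) : dual := Dual (dual_add_subproof chi psi).
Definition dual_zero : dual := Dual dual_zero_subproof.
Definition dual_opp (chi : dual) : dual := Dual (dual_opp_subproof chi).
Arguments dual_add : simpl never.
Arguments dual_zero : simpl never.
Arguments dual_opp : simpl never.

Lemma dual_eqP (chi psi : dual) : (forall a, chi a = psi a) -> chi = psi.
Proof. by move=> h; apply/val_inj/ffunP. Qed.

Fact dual_addA : associative dual_add.
Proof. by move=> x y z; apply: dual_eqP => a; rewrite !ffunE mulrA. Qed.
Fact dual_addC : commutative dual_add.
Proof. by move=> x y; apply: dual_eqP => a; rewrite !ffunE mulrC. Qed.
Fact dual_add0 : left_id dual_zero dual_add.
Proof. by move=> x; apply: dual_eqP => a; rewrite !ffunE mul1r. Qed.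
Fact dual_addN : left_inverse dual_zero dual_opp dual_add.
Proof. by move=> x; apply: dual_eqP => a; rewrite !ffunE mulVf ?char_neq0. Qed.

HB.instance Definition _ :=
  GRing.isZmodule.Build dual dual_addA dual_addC dual_add0 dual_addN.

Lemma dualDE (chi psi : dual) a : (chi + psi) a = chi a * psi a.
Proof. by rewrite ffunE. Qed.
Lemma dual0E a : (0 : dual) a = 1.
Proof. by rewrite ffunE. Qed.
Lemma dualNE (chi : dual) a : (- chi) a = (chi a)^-1.
Proof. by rewrite ffunE. Qed.

Lemma card_mulrn (a : B) : a *+ #|B| = 0.
Proof.
have h : \sum_(x : B) x = \sum_(x : B) (a + x).
  by rewrite (reindex_inj (addrI a)).
by apply: (addIr (\sum_(x : B) x)); rewrite add0r {2}h big_split /= sumr_const.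
Qed.

(* Characters take values in the roots of unity of order #|B|; hence the dual
   is finite. *)
Definition unity_roots : seq C := sval (closed_field_poly_normal ('X^#|B| - 1)).

Lemma char_unity_root (chi : dual) a : chi a \in unity_roots.
Proof.
have B0 : (0 < #|B|)%N by apply/card_gt0P; exists 0.
rewrite /unity_roots; case: closed_field_poly_normal => r /= e.
have : root ('X^#|B| - 1) (chi a).
  by rewrite rootE !hornerE -charMn card_mulrn char0 subrr.
rewrite e rootZ ?root_prod_XsubC //.
by rewrite lead_coef_eq0 -size_poly_eq0 size_XnsubC.
Qed.

Definition dual_code (chi : dual) : {ffun B -> seq_sub unity_roots} :=
  [ffun a => SeqSub (char_unity_root chi a)].
Definition dual_decode (f : {ffun B -> seq_sub unity_roots}) : option dual :=
  insub [ffun a => val (f a)].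
Fact dual_codeK : pcancel dual_code dual_decode.
Proof.
move=> chi; rewrite /dual_decode (_ : [ffun a => _] = val chi) ?valK //.
by apply/ffunP => a; rewrite !ffunE.
Qed.
HB.instance Definition _ := PCanIsCountable dual_codeK.
HB.instance Definition _ := isFinite.Build dual (pcan_enumP dual_codeK).

End Dual.

Section CommonEigenvectors.
Variable C : numClosedFieldType.

Lemma common_eigenvector_in n (W : 'M[C]_n) (As : seq 'M[C]_n) :
    W != 0 -> {in As &, forall X Y, comm_mx X Y} ->
    {in As, forall X, stablemx W X} ->
  exists2 v : 'rV_n, v != 0 & (v <= W)%MS /\ {in As, forall X, stablemx v X}.
Proof.
move=> W0 As_comm As_st.
have st X : X \in As -> stablemx (row_base W) X.
  by move=> XA; rewrite stablemx_row_base; apply: As_st.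
have [] := @common_eigenvector C (\rank W) [seq restrictmx W X | X <- As].
- by rewrite lt0n mxrank_eq0.
- move=> _ _ /mapP[/= X XA ->] /mapP[/= Y YA ->].
  rewrite /comm_mx -conjmxM ?inE ?st // -conjmxM ?inE ?st //.
  by congr (conjmx _ _); apply: As_comm.
move=> v v0 /allP /= vP; exists (v *m row_base W).
  by rewrite mulmx_free_eq0 ?row_base_free.
split=> [|X XA]; first by rewrite mulmx_sub // eq_row_base.
by rewrite -stablemx_restrict ?As_st ?vP //; apply/mapP; exists X.
Qed.

Variable B : finZmodType.

Section Twist.
Variable f : B -> B -> C.
Hypothesis fDl : forall u v w, f (u + v) w = f u w * f v w.
Hypothesis fDr : forall u v w, f u (v + w) = f u v * f u w.
Hypothesis fC : forall u v, f u v = f v u.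
Hypothesis f1 : forall u v, `|f u v| = 1.

Definition twist (u : B) : 'M[C]_#|B| :=
  \matrix_(i, j) (f u (enum_val i) * (enum_val j == u + enum_val i)%:R).

Lemma twistM u w : twist u *m twist w = f u w *: twist (u + w).
Proof.
apply/matrixP => i k; rewrite !mxE (bigD1 (enum_rank (u + enum_val i))) //=.
rewrite big1 ?addr0 => [|j /negPf jn]; last first.
  rewrite !mxE (_ : (enum_val j == _) = false) ?mulr0 ?mul0r //.
  by rewrite -jn -(inj_eq enum_val_inj) enum_rankK.
rewrite !mxE enum_rankK eqxx mulr1 fDr fDl addrA (addrC w) [f w u]fC !mulrA.
by congr (_ * _ * _); apply: mulrC.
Qed.

Lemma twist_comm u w : comm_mx (twist u) (twist w).
Proof. by rewrite /comm_mx !twistM fC addrC. Qed.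

Lemma twist_eigen (W : 'M[C]_#|B|) :
    W != 0 -> (forall u, stablemx W (twist u)) ->
  exists (mu : B -> C) (v : 'rV_#|B|),
    [/\ v != 0, (v <= W)%MS, forall u, v *m twist u = mu u *: v,
        forall u w, mu u * mu w = f u w * mu (u + w) & forall u, `|mu u| = 1].
Proof.
move=> W0 Wst.
have [||v v0 [vW vst]] := @common_eigenvector_in _ W [seq twist u | u : B] W0.
- by move=> _ _ /mapP[u _ ->] /mapP[w _ ->]; apply: twist_comm.
- by move=> _ /mapP[u _ ->].
have vu u : exists a, v *m twist u == a *: v.
  have /sub_rVP[a ->] : stablemx v (twist u).
    by apply/vst/mapP; exists u; rewrite ?mem_enum.
  by exists a.
pose mu u := xchoose (vu u); have muE u : v *m twist u = mu u *: v.
  exact/eqP/(xchooseP (vu u)).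
have muM u w : mu u * mu w = f u w * mu (u + w).
  have : v *m (twist u *m twist w) = v *m (f u w *: twist (u + w)).
    by rewrite twistM.
  rewrite mulmxA muE -scalemxAl -scalemxAr !muE !scalerA.
  by move/eqP; rewrite -subr_eq0 -scalerBl scaler_eq0 (negPf v0) orbF subr_eq0
    => /eqP.
have f0 u w : f u w != 0 by rewrite -normr_gt0 f1 ltr01.
have nD u w : `|mu (u + w)| = `|mu u| * `|mu w|.
  by rewrite -normrM muM normrM f1 mul1r.
have f00 w : f 0 w = 1.
  by apply: (mulfI (f0 0 w)); rewrite -fDl addr0 mulr1.
have mu0 : mu 0 = 1.
  have : v *m twist 0 = v.
    rewrite -[RHS]mulmx1; congr (_ *m _); apply/matrixP => i j; rewrite !mxE.
    by rewrite f00 mul1r add0r (inj_eq enum_val_inj) eq_sym.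
  rewrite muE => /eqP; rewrite -subr_eq0 -{2}[v]scale1r -scalerBl scaler_eq0.
  by rewrite (negPf v0) orbF subr_eq0 => /eqP.
exists mu, v; split=> // u.
have nX n : `|mu (u *+ n)| = `|mu u| ^+ n.
  by elim: n => [|n IH]; rewrite ?mulr0n ?mu0 ?normr1 // mulrS nD IH exprS.
have B0 : (0 < #|B|)%N by apply/card_gt0P; exists 0.
by apply/eqP; rewrite -(@pexpr_eq1 _ _ #|B|) // -nX card_mulrn mu0 normr1.
Qed.

(* Symmetric bicharacters are coboundaries. *)
Lemma symmetric_bichar_split :
  exists mu : B -> C,
    (forall u w, mu u * mu w = f u w * mu (u + w)) /\ (forall u, `|mu u| = 1).
Proof.
have [||mu [v [_ _ _ h1 h2]]] := @twist_eigen (1%:M : 'M[C]_#|B|).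
- by rewrite -mxrank_eq0 mxrank1 -lt0n; apply/card_gt0P; exists 0.
- by move=> u; exact: submx1.
by exists mu.
Qed.
End Twist.

Lemma char_separates (a : B) : a != 0 -> exists chi : dual C B, chi a != 1.
Proof.
move=> a0; pose f (_ _ : B) : C := 1.
have fDl (u v w : B) : f (u + v) w = f u w * f v w by rewrite mulr1.
have fDr (u v w : B) : f u (v + w) = f u v * f u w by rewrite mulr1.
have f1 (u v : B) : `|f u v| = 1 by rewrite normr1.
have fC (u v : B) : f u v = f v u by [].
pose W := twist f a - 1%:M.
have W0 : W != 0.
  rewrite subr_eq0; apply/eqP => /matrixP.
  move/(_ (enum_rank 0) (enum_rank a)); rewrite !mxE !enum_rankK addr0 eqxx.
  rewrite mulr1 (inj_eq enum_rank_inj) eq_sym (negPf a0) => /eqP.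
  by rewrite oner_eq0.
have Wst u : stablemx W (twist f u).
  rewrite mulmxBl mul1mx (twist_comm fDl fDr fC) -{2}[twist f u]mulmx1.
  by rewrite -mulmxBr submxMl.
have [mu [v [v0 vW vE muM mu1]]] := twist_eigen fDl fDr fC f1 W0 Wst.
have chiP : is_char [ffun u => mu u].
  by apply: is_charP => [u w|u]; rewrite !ffunE // muM mul1r.
exists (Dual chiP); rewrite ffunE; apply/eqP => mua.
have B0 : (0 < #|B|)%N by apply/card_gt0P; exists 0.
have /submxP[x vx] := vW.
have vn n : v *m twist f (a *+ n) = v.
  rewrite vE; suff -> : mu (a *+ n) = 1 by rewrite scale1r.
  elim: n => [|n IH]; last first.
    by have := muM a (a *+ n); rewrite mua IH mul1r /f mul1r mulrS.
  have /eqP := muM 0 0; rewrite addr0 mul1r mulr0n -[X in _ == X]mulr1.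
  rewrite -subr_eq0 -mulrBr mulf_eq0 subr_eq0 => /orP[|] /eqP // mu0.
  by have := mu1 0; rewrite mu0 normr0 => /esym/eqP; rewrite oner_eq0.
have xW n : x *m W *m (\sum_(i < n) twist f (a *+ i)) = x *m (twist f (a *+ n) - 1%:M).
  elim: n => [|n IH].
    rewrite big_ord0 mulmx0 mulr0n (_ : twist f 0 = 1%:M) ?subrr ?mulmx0 //.
    apply/matrixP => i j; rewrite !mxE mul1r add0r (inj_eq enum_val_inj).
    by rewrite eq_sym.
  rewrite big_ord_recr /= mulmxDr IH -mulmxA -mulmxDr; congr (_ *m _).
  rewrite mulmxBl mul1mx (twistM fDl fDr fC) scale1r mulrS.
  by rewrite [LHS]addrC addrA subrK.
have := xW #|B|; rewrite -vx mulmx_sumr (eq_bigr (fun=> v)) => [|i _ //].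
rewrite sumr_const card_ord card_mulrn (_ : twist f 0 = 1%:M); last first.
  apply/matrixP => i j; rewrite !mxE mul1r add0r (inj_eq enum_val_inj).
  by rewrite eq_sym.
rewrite subrr mulmx0 -scaler_nat => /eqP; rewrite scaler_eq0 (negPf v0) orbF.
by rewrite pnatr_eq0 => /eqP e; rewrite e in B0.
Qed.
End CommonEigenvectors.

Section Weights.
Variables (C : numClosedFieldType) (V : finZmodType).

Lemma char_sum (chi : dual C V) : \sum_v chi v = if chi == 0 then #|V|%:R else 0.
Proof.
  have [->|chi0] := eqVneq.
    by rewrite (eq_bigr (fun=> 1)) ?sumr_const // => v _; rewrite dual0E.
  have [w chiw] : exists w, chi w != 1.
    apply/existsP; apply: contraR chi0 => /existsPn h; apply/eqP.
    by apply: dual_eqP => v; rewrite dual0E; apply/eqP; rewrite -[_ == _]negbK.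
  have : chi w * \sum_v chi v = \sum_v chi v.
    rewrite mulr_sumr [RHS](reindex_inj (addrI w)).
    by apply: eq_bigr => v _; rewrite charD.
  move/eqP; rewrite -subr_eq0 -{2}[\sum_v _]mul1r -mulrBl mulf_eq0 subr_eq0.
  by rewrite (negPf chiw) => /eqP.
Qed.

Lemma dual_sum (v : V) : \sum_chi (chi : dual C V) v
    = if v == 0 then #|{: dual C V}|%:R else 0.
Proof.
  have [->|v0] := eqVneq.
    by rewrite (eq_bigr (fun=> 1)) ?sumr_const // => chi _; rewrite char0.
  have [psi psiv] := char_separates C v0.
  have : psi v * \sum_chi (chi : dual C V) v = \sum_chi (chi : dual C V) v.
    rewrite mulr_sumr [RHS](reindex_inj (addrI psi)).
    by apply: eq_bigr => chi _; rewrite dualDE.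
  move/eqP; rewrite -subr_eq0 -{2}[\sum_chi _]mul1r -mulrBl mulf_eq0 subr_eq0.
  by rewrite (negPf psiv) => /eqP.
Qed.

Lemma card_dual : #|V|%:R = #|{: dual C V}|%:R :> C.
Proof.
have := @exchange_big C 0 +%R _ _ (index_enum _) (index_enum _) xpredT xpredT
  (fun (chi : dual C V) (v : V) => chi v).
under eq_bigr => chi _ do rewrite char_sum.
under [X in _ = X]eq_bigr => v _ do rewrite dual_sum.
by rewrite -!big_mkcond !big_pred1_eq.
Qed.

Variable U : vectType C.
Implicit Types r : dual C V -> 'End(U).

Definition weight r (v : V) (xi : U) : Prop :=
  forall chi : dual C V, r chi xi = chi v *: xi.

(* The projector onto the v-th summand of U = (+)_v U_v. *)
Definition wproj r (v : V) : 'End(U) :=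
  #|{: dual C V}|%:R^-1 *: \sum_(chi : dual C V) (chi v)^-1 *: r chi.

Variable r : dual C V -> 'End(U).
Hypothesis r0 : r 0 = \1%VF.
Hypothesis rD : forall chi psi : dual C V, r (chi + psi) = (r chi \o r psi)%VF.

Lemma wprojE v xi :
  wproj r v xi = #|{: dual C V}|%:R^-1 *: \sum_(chi : dual C V) (chi v)^-1 *: r chi xi.
Proof.
rewrite /wproj scale_lfunE sum_lfunE; congr (_ *: _).
by apply: eq_bigr => chi _; rewrite scale_lfunE.
Qed.

Lemma wproj_weight v xi : weight r v (wproj r v xi).
Proof.
move=> psi; rewrite wprojE linearZ scalerA mulrC -scalerA; congr (_ *: _).
rewrite linear_sum scaler_sumr [RHS](reindex_inj (addrI psi)) /=.
apply: eq_bigr => chi _.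
rewrite linearZ rD comp_lfunE scalerA dualDE invfM mulrA divff ?mul1r //.
exact: char_neq0.
Qed.

Lemma card_dual_neq0 : #|{: dual C V}|%:R != 0 :> C.
Proof. by rewrite pnatr_eq0 -lt0n; apply/card_gt0P; exists 0. Qed.

Lemma weight_wproj v w xi :
  weight r v xi -> wproj r w xi = if w == v then xi else 0.
Proof.
move=> xiv; rewrite wprojE.
under eq_bigr => chi _ do
  rewrite xiv scalerA -charN -charD.
rewrite -scaler_suml dual_sum addrC subr_eq0 eq_sym.
case: eqVneq => _; last by rewrite scale0r scaler0.
by rewrite scalerA mulVf ?scale1r // card_dual_neq0.
Qed.

Lemma wproj_sum xi : \sum_v wproj r v xi = xi.
Proof.
under eq_bigr => v _ do rewrite wprojE.
rewrite -scaler_sumr exchange_big /= (bigD1 0 isT) /= [X in _ + X]big1 => [|chi chi0].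
  rewrite addr0 r0 id_lfunE -scaler_suml.
  under eq_bigr => v _ do rewrite dual0E invr1.
  by rewrite sumr_const scalerA card_dual mulVf ?scale1r //
    card_dual_neq0.
rewrite -scaler_suml; under eq_bigr => v _ do rewrite -dualNE.
by rewrite char_sum oppr_eq0 (negPf chi0) scale0r.
Qed.

Lemma weight0 v : weight r v 0.
Proof. by move=> chi; rewrite linear0 scaler0. Qed.
Lemma weightD v xi eta : weight r v xi -> weight r v eta -> weight r v (xi + eta).
Proof. by move=> h k chi; rewrite linearD /= h k scalerDr. Qed.
Lemma weightZ v a xi : weight r v xi -> weight r v (a *: xi).
Proof. by move=> h chi; rewrite linearZ /= h !scalerA mulrC. Qed.

(* Linear maps agree as soon as they agree on homogeneous vectors. *)
Lemma weight_ext (W : vectType C) (f g : 'Hom(U, W)) :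
  (forall v xi, weight r v xi -> f xi = g xi) -> f = g.
Proof.
move=> fg; apply/lfunP => xi; rewrite -(wproj_sum xi) !linear_sum.
by apply: eq_bigr => v _; apply/fg/wproj_weight.
Qed.

Lemma sum_wprojE (W : vectType C) (F : V -> 'Hom(U, W)) v xi :
  weight r v xi -> (\sum_w (F w \o wproj r w))%VF xi = F v xi.
Proof.
move=> h; rewrite sum_lfunE (bigD1 v) //= big1 => [|w /negPf wv].
  by rewrite comp_lfunE (weight_wproj _ h) eqxx addr0.
by rewrite comp_lfunE (weight_wproj _ h) wv linear0.
Qed.
End Weights.

Section Groups.
Variables (C : numClosedFieldType) (A : finZmodType).

Definition VA_sum : Type := (A * dual C A)%type.
HB.instance Definition _ := Finite.on VA_sum.
HB.instance Definition _ := GRing.Zmodule.on VA_sum.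
Definition VA : finZmodType := VA_sum.

Definition beta (u v : VA) : C := u.2 v.1.
Definition omega (u v : VA) : C := beta u v * (beta v u)^-1.

Lemma betaDl u v w : beta (u + v) w = beta u w * beta v w.
Proof. exact: dualDE. Qed.
Lemma betaDr u v w : beta u (v + w) = beta u v * beta u w.
Proof. exact: charD. Qed.
Lemma beta_norm u v : `|beta u v| = 1.
Proof. exact: char_norm. Qed.
Lemma beta_neq0 u v : beta u v != 0.
Proof. exact: char_neq0. Qed.

(* Sp(V_A), as a subtype of the permutations of V_A *)
Definition is_sp (T : {perm VA}) : bool :=
  [forall u, forall v, T (u + v) == T u + T v] &&
  [forall u, forall v, omega (T u) (T v) == omega u v].

Record sp := Sp { sp_perm :> {perm VA}; _ : is_sp sp_perm }.
HB.instance Definition _ := [isSub for sp_perm].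
HB.instance Definition _ := [Choice of sp by <:].

Lemma is_spP (T : {perm VA}) :
  (forall u v, T (u + v) = T u + T v) ->
  (forall u v, omega (T u) (T v) = omega u v) -> is_sp T.
Proof.
move=> TD To; apply/andP; split; apply/forallP => u; apply/forallP => v.
  by rewrite TD.
by rewrite To.
Qed.

Lemma spD (T : sp) u v : T (u + v) = T u + T v.
Proof. by case: T => T /= /andP[/forallP/(_ u)/forallP/(_ v)/eqP]. Qed.
Lemma sp_omega (T : sp) u v : omega (T u) (T v) = omega u v.
Proof. by case: T => T /= /andP[_ /forallP/(_ u)/forallP/(_ v)/eqP]. Qed.
Lemma sp_eqP (T S : sp) : (forall u, T u = S u) -> T = S.
Proof. by move=> h; apply/val_inj/permP. Qed.

Fact sp_mul_subproof (T S : sp) : is_sp (sp_perm S * sp_perm T)%g.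
Proof. by apply: is_spP => u v; rewrite !permM ?spD // !sp_omega. Qed.
Fact sp_one_subproof : is_sp 1%g.
Proof. by apply: is_spP => u v; rewrite !perm1. Qed.
Fact sp_inv_subproof (T : sp) : is_sp (sp_perm T)^-1%g.
Proof.
apply: is_spP => u v; last by rewrite -(sp_omega T) !permKV.
by apply: (@perm_inj _ T); rewrite spD !permKV.
Qed.

(* The product T S of automorphisms is the composition u |-> T (S u), which is
   the product S * T for the library's group law on permutations. *)
Definition sp_mul (T S : sp) : sp := Sp (sp_mul_subproof T S).
Definition sp_one : sp := Sp sp_one_subproof.
Definition sp_inv (T : sp) : sp := Sp (sp_inv_subproof T).
Arguments sp_mul : simpl never.
Arguments sp_one : simpl never.
Arguments sp_inv : simpl never.

Fact sp_mulA : associative sp_mul.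
Proof. by move=> T S Q; apply: sp_eqP => u; rewrite !permM. Qed.
Fact sp_mul1 : left_id sp_one sp_mul.
Proof. by move=> T; apply: sp_eqP => u; rewrite permM perm1. Qed.
Fact sp_mulr1 : right_id sp_one sp_mul.
Proof. by move=> T; apply: sp_eqP => u; rewrite permM perm1. Qed.
Fact sp_mulV : left_inverse sp_one sp_inv sp_mul.
Proof. by move=> T; apply: sp_eqP => u; rewrite permM perm1 permK. Qed.
Fact sp_mulrV : right_inverse sp_one sp_inv sp_mul.
Proof. by move=> T; apply: sp_eqP => u; rewrite permM perm1 permKV. Qed.
HB.instance Definition _ :=
  isGroup.Build sp sp_mulA sp_mul1 sp_mulr1 sp_mulV sp_mulrV.

Lemma spME (T S : sp) u : (T * S)%g u = T (S u).
Proof. by rewrite permM. Qed.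
Lemma sp1E u : (1%g : sp) u = u.
Proof. by rewrite perm1. Qed.

Fact dual_comp_subproof (chi : dual C VA) (S : sp) :
  is_char [ffun v => chi (S v)].
Proof.
apply: is_charP => [a b|a]; rewrite !ffunE; first by rewrite spD charD.
by rewrite char_norm.
Qed.

(* chi^S = chi \o S *)
Definition dual_comp (chi : dual C VA) (S : sp) : dual C VA :=
  Dual (dual_comp_subproof chi S).
Arguments dual_comp : simpl never.

Lemma dual_compE chi S v : dual_comp chi S v = chi (S v).
Proof. by rewrite ffunE. Qed.

Record asp := ASp { asp_sp : sp; asp_char : dual C VA }.
Definition asp_pair (g : asp) := (asp_sp g, asp_char g).
Definition pair_asp (p : sp * dual C VA) := ASp p.1 p.2.
Fact asp_pairK : cancel asp_pair pair_asp. Proof. by case. Qed.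
HB.instance Definition _ := Choice.copy asp (can_type asp_pairK).

Definition asp_mul (g h : asp) : asp :=
  ASp (asp_sp g * asp_sp h)%g (dual_comp (asp_char g) (asp_sp h) + asp_char h).
Definition asp_one : asp := ASp 1%g 0.
Definition asp_inv (g : asp) : asp :=
  ASp (asp_sp g)^-1%g (- dual_comp (asp_char g) (asp_sp g)^-1%g).

Lemma asp_mul_sp g h : asp_sp (asp_mul g h) = (asp_sp g * asp_sp h)%g.
Proof. by []. Qed.
Lemma asp_mul_char g h u :
  asp_char (asp_mul g h) u = asp_char g (asp_sp h u) * asp_char h u.
Proof. by rewrite dualDE dual_compE. Qed.
Lemma asp_one_char u : asp_char asp_one u = 1.
Proof. exact: dual0E. Qed.
Lemma asp_inv_char g u :
  asp_char (asp_inv g) u = (asp_char g ((asp_sp g)^-1%g u))^-1.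
Proof. by rewrite dualNE dual_compE. Qed.

Lemma asp_eqP (g h : asp) : (forall u, asp_sp g u = asp_sp h u) ->
  (forall u, asp_char g u = asp_char h u) -> g = h.
Proof.
by case: g h => [T x] [S y] /= /sp_eqP -> /dual_eqP ->.
Qed.

Fact asp_mulA : associative asp_mul.
Proof.
move=> g h k; apply: asp_eqP => u; first by rewrite !asp_mul_sp mulgA.
by rewrite !asp_mul_char asp_mul_sp spME mulrA.
Qed.
Fact asp_mul1 : left_id asp_one asp_mul.
Proof.
move=> g; apply: asp_eqP => u; first by rewrite asp_mul_sp mul1g.
by rewrite asp_mul_char asp_one_char mul1r.
Qed.
Fact asp_mulr1 : right_id asp_one asp_mul.
Proof.
move=> g; apply: asp_eqP => u; first by rewrite asp_mul_sp mulg1.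
by rewrite asp_mul_char asp_one_char sp1E mulr1.
Qed.
Fact asp_mulV : left_inverse asp_one asp_inv asp_mul.
Proof.
move=> g; apply: asp_eqP => u; first by rewrite asp_mul_sp mulVg.
rewrite asp_mul_char asp_one_char asp_inv_char -spME mulVg sp1E mulVf //.
exact: char_neq0.
Qed.
Fact asp_mulrV : right_inverse asp_one asp_inv asp_mul.
Proof.
move=> g; apply: asp_eqP => u; first by rewrite asp_mul_sp mulgV.
by rewrite asp_mul_char asp_one_char asp_inv_char divff // char_neq0.
Qed.
HB.instance Definition _ :=
  isGroup.Build asp asp_mulA asp_mul1 asp_mulr1 asp_mulV asp_mulrV.

(* The group C(A), as the pairs (T, lambda); lambda : V_A -> U(1) is a complex
   function of modulus 1. *)
Definition is_cliff (p : {perm VA} * {ffun VA -> C}) : bool :=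
  let T := p.1 in let lam := p.2 in
  [&& [forall u, forall v, T (u + v) == T u + T v],
      [forall u, `|lam u| == 1] &
      [forall u, forall v,
        lam (u + v) / (lam u * lam v) == beta (T u) (T v) / beta u v]].

Record cliff := Cliff { cliff_pair : {perm VA} * {ffun VA -> C};
                        _ : is_cliff cliff_pair }.
HB.instance Definition _ := [isSub for cliff_pair].
HB.instance Definition _ := [Choice of cliff by <:].

Definition cliff_perm (c : cliff) : {perm VA} := (cliff_pair c).1.
Definition cliff_lam (c : cliff) : VA -> C := (cliff_pair c).2.

Lemma is_cliffP (T : {perm VA}) (lam : {ffun VA -> C}) :
  (forall u v, T (u + v) = T u + T v) -> (forall u, `|lam u| = 1) ->
  (forall u v, lam (u + v) / (lam u * lam v) = beta (T u) (T v) / beta u v) ->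
  is_cliff (T, lam).
Proof.
move=> h1 h2 h3; apply/and3P; split; apply/forallP => u; rewrite ?h2 //.
  by apply/forallP => v; rewrite h1.
by apply/forallP => v; rewrite h3.
Qed.

Lemma cliff_permD c u v : cliff_perm c (u + v) = cliff_perm c u + cliff_perm c v.
Proof. by have /and3P[/forallP/(_ u)/forallP/(_ v)/eqP] := valP c. Qed.
Lemma cliff_lam_norm c u : `|cliff_lam c u| = 1.
Proof. by have /and3P[_ /forallP/(_ u)/eqP] := valP c. Qed.
Lemma cliff_lam_neq0 c u : cliff_lam c u != 0.
Proof. by rewrite -normr_gt0 cliff_lam_norm ltr01. Qed.
Lemma cliff_lamP c u v : cliff_lam c (u + v) / (cliff_lam c u * cliff_lam c v)
  = beta (cliff_perm c u) (cliff_perm c v) / beta u v.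
Proof. by have /and3P[_ _ /forallP/(_ u)/forallP/(_ v)/eqP] := valP c. Qed.
Lemma cliff_lamD c u v : cliff_lam c (u + v) =
  cliff_lam c u * cliff_lam c v *
  (beta (cliff_perm c u) (cliff_perm c v) / beta u v).
Proof. by rewrite -cliff_lamP mulrC divfK // mulf_neq0 ?cliff_lam_neq0. Qed.

Lemma cliff_lam0 c : cliff_lam c 0 = 1.
Proof.
have T0 : cliff_perm c 0 = 0.
  by apply: (addrI (cliff_perm c 0)); rewrite -cliff_permD !addr0.
apply: (mulfI (cliff_lam_neq0 c 0)); rewrite mulr1.
have := cliff_lamD c 0 0.
by rewrite T0 addr0 divff ?beta_neq0 // mulr1.
Qed.

Lemma cliff_sp_subproof c : is_sp (cliff_perm c).
Proof.
apply: is_spP => u v; first exact: cliff_permD.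
have h : beta (cliff_perm c u) (cliff_perm c v) / beta u v =
         beta (cliff_perm c v) (cliff_perm c u) / beta v u.
  by rewrite -!cliff_lamP addrC [_ c u * _]mulrC.
move/eqP: h; rewrite eqr_div ?beta_neq0 // => /eqP h.
by apply/eqP; rewrite /omega eqr_div ?beta_neq0 // h mulrC.
Qed.

(* the projection (T, lambda) |-> T onto Sp(V_A) *)
Definition cliff_sp (c : cliff) : sp := Sp (cliff_sp_subproof c).

Lemma cliff_eqP (c d : cliff) : (forall u, cliff_sp c u = cliff_sp d u) ->
  (forall u, cliff_lam c u = cliff_lam d u) -> c = d.
Proof.
move=> hT hl; apply/val_inj; case: c d hT hl => -[T l] h [[S m] k] /= hT hl.
by congr (_, _); [apply/permP|apply/ffunP].
Qed.

Fact mk_cliff_subproof (T : sp) (lam : VA -> C) :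
  (forall u, `|lam u| = 1) ->
  (forall u v, lam (u + v) / (lam u * lam v) = beta (T u) (T v) / beta u v) ->
  is_cliff (sp_perm T, finfun lam).
Proof.
by move=> h1 h2; apply: is_cliffP => *; rewrite ?ffunE ?spD ?h1 ?h2.
Qed.

Definition mk_cliff (T : sp) (lam : VA -> C) (lam1 : forall u, `|lam u| = 1)
  (lamP : forall u v,
     lam (u + v) / (lam u * lam v) = beta (T u) (T v) / beta u v) : cliff :=
  Cliff (mk_cliff_subproof lam1 lamP).

Lemma mk_cliff_sp T lam h1 h2 : cliff_sp (@mk_cliff T lam h1 h2) = T.
Proof. by apply: sp_eqP. Qed.
Lemma mk_cliff_lam T lam h1 h2 u : cliff_lam (@mk_cliff T lam h1 h2) u = lam u.
Proof. by rewrite /cliff_lam /= ffunE. Qed.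

Fact cliff_mul1_subproof (c d : cliff) u :
  `|cliff_lam c (cliff_sp d u) * cliff_lam d u| = 1.
Proof. by rewrite normrM !cliff_lam_norm mulr1. Qed.
Fact cliff_mul2_subproof (c d : cliff) u v
    (lam := fun w => cliff_lam c (cliff_sp d w) * cliff_lam d w) :
  lam (u + v) / (lam u * lam v) =
  beta ((cliff_sp c * cliff_sp d)%g u) ((cliff_sp c * cliff_sp d)%g v)
  / beta u v.
Proof.
rewrite /lam !spME spD mulrACA -mulf_div !cliff_lamP -/(cliff_sp c) /=.
by rewrite mulrA divfK ?beta_neq0.
Qed.
Fact cliff_one2_subproof (u v : VA) :
  1 / (1 * 1) = beta ((1%g : sp) u) ((1%g : sp) v) / beta u v :> C.
Proof. by rewrite !sp1E mulr1 divr1 divff ?beta_neq0. Qed.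
Fact cliff_inv1_subproof (c : cliff) u :
  `|(cliff_lam c ((cliff_sp c)^-1%g u))^-1| = 1.
Proof. by rewrite normfV cliff_lam_norm invr1. Qed.
Fact cliff_inv2_subproof (c : cliff) u v
    (lam := fun w => (cliff_lam c ((cliff_sp c)^-1%g w))^-1) :
  lam (u + v) / (lam u * lam v) =
  beta ((cliff_sp c)^-1%g u) ((cliff_sp c)^-1%g v) / beta u v.
Proof.
rewrite /lam spD -invfM -invfM cliff_lamP invfM invrK mulrC.
by congr (_ / beta _ _); rewrite -/(cliff_sp c _) -spME mulgV sp1E.
Qed.

(* (T, lambda) (S, mu) = (T S, (lambda \o S) mu) *)
Definition cliff_mul (c d : cliff) : cliff :=
  mk_cliff (cliff_mul1_subproof c d) (cliff_mul2_subproof c d).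
Definition cliff_one : cliff :=
  mk_cliff (fun _ : VA => normr1 C) cliff_one2_subproof.
Definition cliff_inv (c : cliff) : cliff :=
  mk_cliff (cliff_inv1_subproof c) (cliff_inv2_subproof c).
Arguments cliff_mul : simpl never.
Arguments cliff_one : simpl never.
Arguments cliff_inv : simpl never.

Lemma cliff_mul_sp c d :
  cliff_sp (cliff_mul c d) = (cliff_sp c * cliff_sp d)%g.
Proof. exact: mk_cliff_sp. Qed.
Lemma cliff_mul_lam c d u :
  cliff_lam (cliff_mul c d) u = cliff_lam c (cliff_sp d u) * cliff_lam d u.
Proof. exact: mk_cliff_lam. Qed.
Lemma cliff_one_sp : cliff_sp cliff_one = 1%g.
Proof. exact: mk_cliff_sp. Qed.
Lemma cliff_one_lam u : cliff_lam cliff_one u = 1.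
Proof. exact: mk_cliff_lam. Qed.
Lemma cliff_inv_sp c : cliff_sp (cliff_inv c) = (cliff_sp c)^-1%g.
Proof. exact: mk_cliff_sp. Qed.
Lemma cliff_inv_lam c u :
  cliff_lam (cliff_inv c) u = (cliff_lam c ((cliff_sp c)^-1%g u))^-1.
Proof. exact: mk_cliff_lam. Qed.

Fact cliff_mulA : associative cliff_mul.
Proof.
move=> c d e; apply: cliff_eqP => u; first by rewrite !cliff_mul_sp mulgA.
by rewrite !cliff_mul_lam cliff_mul_sp spME mulrA.
Qed.
Fact cliff_mul1 : left_id cliff_one cliff_mul.
Proof.
move=> c; apply: cliff_eqP => u; first by rewrite cliff_mul_sp cliff_one_sp mul1g.
by rewrite cliff_mul_lam cliff_one_lam mul1r.
Qed.
Fact cliff_mulr1 : right_id cliff_one cliff_mul.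
Proof.
move=> c; apply: cliff_eqP => u; first by rewrite cliff_mul_sp cliff_one_sp mulg1.
by rewrite cliff_mul_lam cliff_one_lam cliff_one_sp sp1E mulr1.
Qed.
Fact cliff_mulV : left_inverse cliff_one cliff_inv cliff_mul.
Proof.
move=> c; apply: cliff_eqP => u.
  by rewrite cliff_mul_sp cliff_one_sp cliff_inv_sp mulVg.
by rewrite cliff_mul_lam cliff_inv_lam cliff_one_lam -spME mulVg sp1E mulVf
  ?cliff_lam_neq0.
Qed.
Fact cliff_mulrV : right_inverse cliff_one cliff_inv cliff_mul.
Proof.
move=> c; apply: cliff_eqP => u.
  by rewrite cliff_mul_sp cliff_one_sp cliff_inv_sp mulgV.
by rewrite cliff_mul_lam cliff_inv_lam cliff_one_lam cliff_inv_sp divff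
  ?cliff_lam_neq0.
Qed.
HB.instance Definition _ :=
  isGroup.Build cliff cliff_mulA cliff_mul1 cliff_mulr1 cliff_mulV cliff_mulrV.

Lemma cliff_spM (c d : cliff) : cliff_sp (c * d)%g = (cliff_sp c * cliff_sp d)%g.
Proof. exact: cliff_mul_sp. Qed.
Lemma cliff_sp1 : cliff_sp 1%g = 1%g.
Proof. exact: cliff_one_sp. Qed.
Lemma cliff_lamM (c d : cliff) u :
  cliff_lam (c * d)%g u = cliff_lam c (cliff_sp d u) * cliff_lam d u.
Proof. exact: cliff_mul_lam. Qed.
Lemma cliff_lam1 u : cliff_lam 1%g u = 1.
Proof. exact: cliff_one_lam. Qed.

(* The projection C(A) -> Sp(V_A) is onto. *)
Lemma cliff_sp_surj (T : sp) : exists c : cliff, cliff_sp c = T.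
Proof.
pose f (u v : VA) := beta u v / beta (T u) (T v).
have f0 u v : f u v != 0 by rewrite mulf_neq0 ?invr_eq0 ?beta_neq0.
have fDl (u v w : VA) : f (u + v) w = f u w * f v w.
  by rewrite /f spD !betaDl mulf_div.
have fDr (u v w : VA) : f u (v + w) = f u v * f u w.
  by rewrite /f spD !betaDr mulf_div.
have fC (u v : VA) : f u v = f v u.
  have /eqP := sp_omega T u v; rewrite /omega eqr_div ?beta_neq0 // => /eqP e.
  by apply/eqP; rewrite /f eqr_div ?beta_neq0 // -e mulrC.
have f1 (u v : VA) : `|f u v| = 1.
  by rewrite normrM normfV !beta_norm invr1 mulr1.
have [mu [muM mu1]] := symmetric_bichar_split fDl fDr fC f1.
have mu0 u : mu u != 0 by rewrite -normr_gt0 mu1 ltr01.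
have h u v : mu (u + v) / (mu u * mu v) = beta (T u) (T v) / beta u v.
  by rewrite muM invfM mulrCA divff // mulr1 /f invf_div.
by exists (mk_cliff mu1 h); apply: mk_cliff_sp.
Qed.

(* chi |-> (id, chi) in ASp(A) and in C(A) *)
Definition asp_trans (chi : dual C VA) : asp := ASp 1%g chi.

Fact cliff_trans_subproof (chi : dual C VA) (u v : VA) :
  chi (u + v) / (chi u * chi v) =
  beta ((1%g : sp) u) ((1%g : sp) v) / beta u v.
Proof.
by rewrite charD !sp1E !divff ?beta_neq0 // mulf_neq0 ?char_neq0.
Qed.
Definition cliff_trans (chi : dual C VA) : cliff :=
  mk_cliff (char_norm chi) (cliff_trans_subproof chi).
Arguments cliff_trans : simpl never.

Lemma asp_trans0 : asp_trans 0 = 1%g. Proof. by []. Qed.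
Lemma asp_transD chi psi :
  asp_trans (chi + psi) = (asp_trans chi * asp_trans psi)%g.
Proof.
apply: asp_eqP => u; first by rewrite asp_mul_sp mulg1.
by rewrite asp_mul_char dualDE sp1E.
Qed.

Lemma cliff_trans_sp chi : cliff_sp (cliff_trans chi) = 1%g.
Proof. exact: mk_cliff_sp. Qed.
Lemma cliff_trans_lam chi u : cliff_lam (cliff_trans chi) u = chi u.
Proof. exact: mk_cliff_lam. Qed.
Lemma cliff_trans0 : cliff_trans 0 = 1%g.
Proof.
apply: cliff_eqP => u; first by rewrite cliff_trans_sp cliff_sp1.
by rewrite cliff_trans_lam cliff_lam1 dual0E.
Qed.
Lemma cliff_transD chi psi :
  cliff_trans (chi + psi) = (cliff_trans chi * cliff_trans psi)%g.
Proof.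
apply: cliff_eqP => u; first by rewrite cliff_spM !cliff_trans_sp mulg1.
by rewrite cliff_lamM !cliff_trans_lam cliff_trans_sp sp1E dualDE.
Qed.
End Groups.

(* K-linear monoidal categories.  The tensor categories of interest are moreover
   abelian and rigid, but these are properties of the underlying monoidal
   category, on which tensor functors carry no further data. *)
Record linCat (K : fieldType) := LinCat {
  obj :> Type;
  hom : obj -> obj -> lmodType K;
  idm : forall X, hom X X;
  comp : forall X Y Z, hom Y Z -> hom X Y -> hom X Z;
  compA : forall X Y Z T (h : hom Z T) (g : hom Y Z) (f : hom X Y),
    comp h (comp g f) = comp (comp h g) f;
  comp1m : forall X Y (f : hom X Y), comp (idm Y) f = f;
  compm1 : forall X Y (f : hom X Y), comp f (idm X) = f;
  comp_linl : forall X Y Z (f : hom X Y), linear (fun g : hom Y Z => comp g f);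
  comp_linr : forall X Y Z (g : hom Y Z), linear (fun f : hom X Y => comp g f)
}.
Arguments hom {K l} X Y.
Arguments idm {K l} X.
Arguments comp {K l X Y Z} g f.

Definition is_iso (K : fieldType) (D : linCat K) (X Y : D) (f : hom X Y) : Prop :=
  exists g : hom Y X, comp g f = idm X /\ comp f g = idm Y.

Record tensorCat (K : fieldType) := TensorCat {
  tcat :> linCat K;
  tens : tcat -> tcat -> tcat;
  tensm : forall X X' Y Y' : tcat,
    hom X X' -> hom Y Y' -> hom (tens X Y) (tens X' Y');
  tunit : tcat;
  tassoc : forall X Y Z : tcat, hom (tens (tens X Y) Z) (tens X (tens Y Z));
  tlunit : forall X : tcat, hom (tens tunit X) X;
  trunit : forall X : tcat, hom (tens X tunit) X;
  tensm_id : forall X Y, tensm (idm X) (idm Y) = idm (tens X Y);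
  tensm_comp : forall X X' X'' Y Y' Y'' (f' : hom X' X'') (f : hom X X')
    (g' : hom Y' Y'') (g : hom Y Y'),
    tensm (comp f' f) (comp g' g) = comp (tensm f' g') (tensm f g);
  tensm_linl : forall X X' Y Y' (g : hom Y Y'),
    linear (fun f : hom X X' => tensm f g);
  tensm_linr : forall X X' Y Y' (f : hom X X'),
    linear (fun g : hom Y Y' => tensm f g);
  tassoc_iso : forall X Y Z, is_iso (tassoc X Y Z);
  tlunit_iso : forall X, is_iso (tlunit X);
  trunit_iso : forall X, is_iso (trunit X);
  tassoc_nat : forall X X' Y Y' Z Z' (f : hom X X') (g : hom Y Y') (h : hom Z Z'),
    comp (tassoc X' Y' Z') (tensm (tensm f g) h) =
    comp (tensm f (tensm g h)) (tassoc X Y Z);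
  tlunit_nat : forall X X' (f : hom X X'),
    comp (tlunit X') (tensm (idm tunit) f) = comp f (tlunit X);
  trunit_nat : forall X X' (f : hom X X'),
    comp (trunit X') (tensm f (idm tunit)) = comp f (trunit X);
  tpentagon : forall X Y Z T,
    comp (tassoc X Y (tens Z T)) (tassoc (tens X Y) Z T) =
    comp (tensm (idm X) (tassoc Y Z T))
      (comp (tassoc X (tens Y Z) T) (tensm (tassoc X Y Z) (idm T)));
  ttriangle : forall X Y,
    comp (tensm (idm X) (tlunit Y)) (tassoc X tunit Y) =
    tensm (trunit X) (idm Y)
}.
Arguments tens {K t} X Y.
Arguments tensm {K t X X' Y Y'} f g.
Arguments tunit {K t}.
Arguments tassoc {K t} X Y Z.
Arguments tlunit {K t} X.
Arguments trunit {K t} X.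

Record functor (K : fieldType) (D E : linCat K) := Functor {
  fobj :> D -> E;
  fmap : forall X Y, hom X Y -> hom (fobj X) (fobj Y);
  fmap_id : forall X, fmap (idm X) = idm (fobj X);
  fmap_comp : forall X Y Z (g : hom Y Z) (f : hom X Y),
    fmap (comp g f) = comp (fmap g) (fmap f);
  fmap_lin : forall X Y, linear (fmap (X := X) (Y := Y))
}.
Arguments fmap {K D E} f0 {X Y} f.

Section TensorStructure.
Variables (K : fieldType) (D E : tensorCat K).

Record tensorStructure (F : functor D E) := TensorStructure {
  tsJ : forall X Y : D, hom (tens (F X) (F Y)) (F (tens X Y));
  tsU : hom tunit (F tunit);
  tsJ_iso : forall X Y, is_iso (tsJ X Y);
  tsU_iso : is_iso tsU;
  tsJ_nat : forall X X' Y Y' (f : hom X X') (g : hom Y Y'),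
    comp (tsJ X' Y') (tensm (fmap F f) (fmap F g)) =
    comp (fmap F (tensm f g)) (tsJ X Y);
  tsJ_assoc : forall X Y Z,
    comp (fmap F (tassoc X Y Z))
      (comp (tsJ (tens X Y) Z) (tensm (tsJ X Y) (idm (F Z)))) =
    comp (tsJ X (tens Y Z))
      (comp (tensm (idm (F X)) (tsJ Y Z)) (tassoc (F X) (F Y) (F Z)));
  tsJ_lunit : forall X,
    comp (fmap F (tlunit X)) (comp (tsJ tunit X) (tensm tsU (idm (F X)))) =
    tlunit (F X);
  tsJ_runit : forall X,
    comp (fmap F (trunit X)) (comp (tsJ X tunit) (tensm (idm (F X)) tsU)) =
    trunit (F X)
}.

Record tensorFunctor := TensorFunctor {
  tf_fun :> functor D E;
  tf_str :> tensorStructure tf_fun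
}.
End TensorStructure.
Arguments tsU {K D E F} t.

Section IsoLemmas.
Variables (K : fieldType) (D E : linCat K).

Lemma is_iso_id (X : D) : is_iso (idm X).
Proof. by exists (idm X); rewrite comp1m. Qed.

Lemma is_iso_comp (X Y Z : D) (g : hom Y Z) (f : hom X Y) :
  is_iso g -> is_iso f -> is_iso (comp g f).
Proof.
move=> [g' [g1 g2]] [f' [f1 f2]]; exists (comp f' g'); split.
  by rewrite compA -(compA f') g1 compm1.
by rewrite compA -(compA g) f2 compm1.
Qed.

Lemma is_iso_fmap (F : functor D E) (X Y : D) (f : hom X Y) :
  is_iso f -> is_iso (fmap F f).
Proof.
by move=> [g [h1 h2]]; exists (fmap F g); rewrite -!fmap_comp h1 h2 !fmap_id.
Qed.
End IsoLemmas.

Section IdComp.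
Variable K : fieldType.

Section Id.
Variable D : tensorCat K.

Definition functor_id (D0 : linCat K) : functor D0 D0 :=
  @Functor K D0 D0 id (fun X Y f => f) (fun X => erefl)
    (fun X Y Z g f => erefl) (fun X Y a f g => erefl).

Fact idJ_nat (X X' Y Y' : D) (f : hom X X') (g : hom Y Y') :
  comp (idm (tens X' Y')) (tensm f g) = comp (tensm f g) (idm (tens X Y)).
Proof. by rewrite comp1m compm1. Qed.
Fact idJ_assoc (X Y Z : D) :
  comp (tassoc X Y Z)
    (comp (idm (tens (tens X Y) Z)) (tensm (idm (tens X Y)) (idm Z))) =
  comp (idm (tens X (tens Y Z)))
    (comp (tensm (idm X) (idm (tens Y Z))) (tassoc X Y Z)).
Proof. by rewrite !tensm_id !comp1m !compm1. Qed.
Fact idJ_lunit (X : D) :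
  comp (tlunit X) (comp (idm (tens tunit X)) (tensm (idm tunit) (idm X))) =
  tlunit X.
Proof. by rewrite tensm_id !compm1. Qed.
Fact idJ_runit (X : D) :
  comp (trunit X) (comp (idm (tens X tunit)) (tensm (idm X) (idm tunit))) =
  trunit X.
Proof. by rewrite tensm_id !compm1. Qed.

Definition tf_id : tensorFunctor D D :=
  TensorFunctor (@TensorStructure K D D (functor_id D)
    (fun X Y => idm (tens X Y)) (idm tunit) (fun X Y => is_iso_id (tens X Y))
    (is_iso_id tunit) idJ_nat idJ_assoc idJ_lunit idJ_runit).
End Id.

Section FunctorComp.
Variables (D E M : linCat K) (G : functor E M) (F : functor D E).

Fact compF_id X : fmap G (fmap F (idm X)) = idm (G (F X)).
Proof. by rewrite !fmap_id. Qed.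
Fact compF_comp X Y Z (g : hom Y Z) (f : hom X Y) :
  fmap G (fmap F (comp g f)) = comp (fmap G (fmap F g)) (fmap G (fmap F f)).
Proof. by rewrite !fmap_comp. Qed.
Fact compF_lin X Y : linear (fun f : hom X Y => fmap G (fmap F f)).
Proof. by move=> a f g; rewrite !fmap_lin. Qed.

Definition functor_comp : functor D M :=
  @Functor K D M (fun X => G (F X)) (fun X Y f => fmap G (fmap F f))
    compF_id compF_comp compF_lin.
End FunctorComp.

Section Comp.
Variables (D E M : tensorCat K) (G : tensorFunctor E M) (F : tensorFunctor D E).
Let H := functor_comp G F.

Definition compJ (X Y : D) : hom (tens (H X) (H Y)) (H (tens X Y)) :=
  comp (fmap G (tsJ F X Y)) (tsJ G (F X) (F Y)).
Definition compU : hom tunit (H tunit) := comp (fmap G (tsU F)) (tsU G).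

Fact compJ_iso X Y : is_iso (compJ X Y).
Proof. by apply: is_iso_comp; [apply: is_iso_fmap|]; apply: tsJ_iso. Qed.
Fact compU_iso : is_iso compU.
Proof. by apply: is_iso_comp; [apply: is_iso_fmap|]; apply: tsU_iso. Qed.
Fact compJ_nat X X' Y Y' (f : hom X X') (g : hom Y Y') :
  comp (compJ X' Y') (tensm (fmap H f) (fmap H g)) =
  comp (fmap H (tensm f g)) (compJ X Y).
Proof.
by rewrite /compJ /= -compA tsJ_nat !compA -!fmap_comp tsJ_nat.
Qed.
Fact compJ_assoc X Y Z :
  comp (fmap H (tassoc X Y Z))
    (comp (compJ (tens X Y) Z) (tensm (compJ X Y) (idm (H Z)))) =
  comp (compJ X (tens Y Z))
    (comp (tensm (idm (H X)) (compJ Y Z)) (tassoc (H X) (H Y) (H Z))).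
Proof.
rewrite /compJ /=.
rewrite -{1}[idm (G (F Z))](compm1 (idm _)) -{1}(fmap_id G (F Z)) tensm_comp.
rewrite -{1}[idm (G (F X))](compm1 (idm _)) -{1}(fmap_id G (F X)) tensm_comp.
rewrite -!compA [in LHS](compA (tsJ G _ _)) tsJ_nat.
rewrite [in RHS](compA (tsJ G (F X) _)) tsJ_nat -!compA -tsJ_assoc.
rewrite !compA -!fmap_comp; congr (comp (comp (fmap G _) _) _).
by rewrite -!compA (tsJ_assoc F).
Qed.
Fact compJ_lunit X :
  comp (fmap H (tlunit X)) (comp (compJ tunit X) (tensm compU (idm (H X)))) =
  tlunit (H X).
Proof.
rewrite /compJ /compU /=.
rewrite -{1}[idm (G (F X))](compm1 (idm _)) -{1}(fmap_id G (F X)) tensm_comp.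
rewrite -!compA (compA (tsJ G _ _)) tsJ_nat -(tsJ_lunit G) -(tsJ_lunit F).
by rewrite !compA -!fmap_comp -!compA.
Qed.
Fact compJ_runit X :
  comp (fmap H (trunit X)) (comp (compJ X tunit) (tensm (idm (H X)) compU)) =
  trunit (H X).
Proof.
rewrite /compJ /compU /=.
rewrite -{1}[idm (G (F X))](compm1 (idm _)) -{1}(fmap_id G (F X)) tensm_comp.
rewrite -!compA (compA (tsJ G _ _)) tsJ_nat -(tsJ_runit G) -(tsJ_runit F).
by rewrite !compA -!fmap_comp -!compA.
Qed.

Definition tf_comp : tensorFunctor D M :=
  TensorFunctor (TensorStructure compJ_iso compU_iso compJ_nat compJ_assoc
                   compJ_lunit compJ_runit).
End Comp.

(* G is a strict two-sided inverse of F *)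
Definition tf_inverse (D E : tensorCat K)
    (F : tensorFunctor D E) (G : tensorFunctor E D) : Prop :=
  tf_comp G F = tf_id D /\ tf_comp F G = tf_id E.

Definition tf_isomorphism (D E : tensorCat K) (F : tensorFunctor D E) : Prop :=
  exists G : tensorFunctor E D, tf_inverse F G.
End IdComp.

(* The tensor product of U and W is modelled by the matrices of coefficients
   with respect to the bases (e_i) = vbasis {:U} and (f_j) = vbasis {:W}: the
   pure tensor x (x) y is the matrix (x_i y_j). *)
Section VectTensor.
Variable C : fieldType.
Implicit Types U W Z T : vectType C.

Definition vtens U W : vectType C := 'M[C]_(\dim {:U}, \dim {:W}).

Definition vpure U W (x : U) (y : W) : vtens U W :=
  \matrix_(i, j) (coord (vbasis {:U}) i x * coord (vbasis {:W}) j y).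

Definition vbase U (i : 'I_(\dim {:U})) : U := (vbasis {:U})`_i.

Lemma vbaseE U (x : U) : x = \sum_i coord (vbasis {:U}) i x *: vbase i.
Proof. exact: (coord_vbasis (memvf x)). Qed.

Lemma coord_vbase U (i j : 'I_(\dim {:U})) :
  coord (vbasis {:U}) i (vbase j) = (j == i)%:R.
Proof. by rewrite coord_free ?(basis_free (vbasisP _)). Qed.

(* The linear map on U (x) W induced by a bilinear map b on U x W. *)
Section Lift.
Variables (U W Z : vectType C) (b : U -> W -> Z).

Definition vlift_fun (t : vtens U W) : Z :=
  \sum_i \sum_j (t : 'M_(_, _)) i j *: b (vbase i) (vbase j).

Fact vlift_linear : linear vlift_fun.
Proof.
move=> a s t; rewrite scaler_sumr -big_split; apply: eq_bigr => i _ /=.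
rewrite scaler_sumr -big_split; apply: eq_bigr => j _ /=.
by rewrite !mxE scalerDl scalerA.
Qed.
HB.instance Definition _ := GRing.isLinear.Build C _ _ _ vlift_fun vlift_linear.

Definition vlift : 'Hom(vtens U W, Z) := linfun vlift_fun.

Lemma vliftE x y : (forall y', linear (b^~ y')) -> (forall x', linear (b x')) ->
  vlift (vpure x y) = b x y.
Proof.
move=> bl br; rewrite lfunE /= /vlift_fun.
pose bL y' := GRing.isLinear.Build C _ _ _ (b^~ y') (bl y').
pose bR x' := GRing.isLinear.Build C _ _ _ (b x') (br x').
pose fL y' : {linear U -> Z} := HB.pack (b^~ y') (bL y').
pose fR x' : {linear W -> Z} := HB.pack (b x') (bR x').
rewrite {2}[x]vbaseE -[RHS]/(fL y _) linear_sum; apply: eq_bigr => i _.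
rewrite linearZ /= -[b _ y]/(fR _ y) {2}[y]vbaseE linear_sum scaler_sumr.
apply: eq_bigr => j _; rewrite linearZ /= scalerA; congr (_ *: _).
by rewrite mxE.
Qed.
End Lift.

Lemma vlift_param U W Z (b1 b2 b3 : U -> W -> Z) a t :
  (forall x y, b3 x y = a *: b1 x y + b2 x y) ->
  vlift b3 t = a *: vlift b1 t + vlift b2 t.
Proof.
move=> h; rewrite !lfunE /= /vlift_fun scaler_sumr -big_split.
apply: eq_bigr => i _ /=; rewrite scaler_sumr -big_split; apply: eq_bigr => j _ /=.
by rewrite h scalerDr !scalerA mulrC.
Qed.

Lemma vpure_linl U W (y : W) : linear (fun x : U => vpure x y).
Proof.
move=> a x x'; apply/matrixP => i j.
by rewrite !mxE linearP /= mulrDl mulrA.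
Qed.
Lemma vpure_linr U W (x : U) : linear (fun y : W => vpure x y).
Proof.
move=> a y y'; apply/matrixP => i j.
by rewrite !mxE linearP /= mulrDr mulrCA.
Qed.

Lemma vpureZl U W a (x : U) (y : W) : vpure (a *: x) y = a *: vpure x y.
Proof. by apply/matrixP => i j; rewrite !mxE linearZ /= mulrA. Qed.
Lemma vpureZr U W a (x : U) (y : W) : vpure x (a *: y) = a *: vpure x y.
Proof. by apply/matrixP => i j; rewrite !mxE linearZ /= mulrCA. Qed.
Lemma vpure_unitl U (a : C^o) (x : U) : vpure a x = a *: vpure (1 : C^o) x.
Proof. by rewrite -vpureZl [a *: _]mulr1. Qed.
Lemma vpure_unitr U (a : C^o) (x : U) : vpure x a = a *: vpure x (1 : C^o).
Proof. by rewrite -vpureZr [a *: _]mulr1. Qed.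

Lemma vtens_ext U W Z (f g : 'Hom(vtens U W, Z)) :
  (forall x y, f (vpure x y) = g (vpure x y)) -> f = g.
Proof.
move=> h; apply/lfunP => t.
rewrite (_ : t = \sum_i \sum_j (t : 'M_(_, _)) i j *: vpure (vbase i) (vbase j)).
  rewrite !linear_sum; apply: eq_bigr => i _.
  rewrite !linear_sum; apply: eq_bigr => j _.
  by rewrite !linearZ /= h.
rewrite [LHS](matrix_sum_delta (t : 'M_(_, _))); apply: eq_bigr => i _.
apply: eq_bigr => j _; congr (_ *: _).
apply/matrixP => k l; rewrite !mxE !coord_vbase -natrM mulnb.
by rewrite (eq_sym k) (eq_sym l).
Qed.

Definition vpure_l U W (y : W) (x : U) : vtens U W := vpure x y.
Definition vpure_r U W (x : U) (y : W) : vtens U W := vpure x y.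
HB.instance Definition _ U W (y : W) :=
  GRing.isLinear.Build C U (vtens U W) _ (@vpure_l U W y) (vpure_linl y).
HB.instance Definition _ U W (x : U) :=
  GRing.isLinear.Build C W (vtens U W) _ (@vpure_r U W x) (vpure_linr x).

Lemma vpure_lE U W (y : W) (x : U) : linfun (vpure_l y) x = vpure x y.
Proof. by rewrite lfunE. Qed.
Lemma vpure_rE U W (x : U) (y : W) : linfun (vpure_r x) y = vpure x y.
Proof. by rewrite lfunE. Qed.

Lemma vtens3_extl U W Z T (f g : 'Hom(vtens (vtens U W) Z, T)) :
  (forall x y z, f (vpure (vpure x y) z) = g (vpure (vpure x y) z)) -> f = g.
Proof.
move=> h; apply: vtens_ext => t z.
have e : (f \o linfun (vpure_l z) = g \o linfun (vpure_l z))%VF.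
  by apply: vtens_ext => x y; rewrite !comp_lfunE !vpure_lE h.
by have /lfunP/(_ t) := e; rewrite !comp_lfunE !(vpure_lE, vpure_rE).
Qed.

Lemma vtens3_extr U W Z T (f g : 'Hom(vtens U (vtens W Z), T)) :
  (forall x y z, f (vpure x (vpure y z)) = g (vpure x (vpure y z))) -> f = g.
Proof.
move=> h; apply: vtens_ext => x t.
have e : (f \o linfun (vpure_r x) = g \o linfun (vpure_r x))%VF.
  by apply: vtens_ext => y z; rewrite !comp_lfunE !vpure_rE h.
by have /lfunP/(_ t) := e; rewrite !comp_lfunE !(vpure_lE, vpure_rE).
Qed.

Lemma vtens4_extl U W Z T (V : vectType C) (f g : 'Hom(vtens (vtens (vtens U W) Z) T, V)) :
  (forall x y z t, f (vpure (vpure (vpure x y) z) t) =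
                   g (vpure (vpure (vpure x y) z) t)) -> f = g.
Proof.
move=> h; apply: vtens_ext => s t.
have e : (f \o linfun (vpure_l t) = g \o linfun (vpure_l t))%VF.
  by apply: vtens3_extl => x y z; rewrite !comp_lfunE !vpure_lE h.
by have /lfunP/(_ s) := e; rewrite !comp_lfunE !(vpure_lE, vpure_rE).
Qed.

(* f (x) g *)
Definition vtensm U U' W W' (f : 'Hom(U, U')) (g : 'Hom(W, W')) :
  'Hom(vtens U W, vtens U' W') := vlift (fun x y => vpure (f x) (g y)).

Lemma vtensmE U U' W W' (f : 'Hom(U, U')) (g : 'Hom(W, W')) x y :
  vtensm f g (vpure x y) = vpure (f x) (g y).
Proof.
by apply: vliftE => [y' a u v|x' a u v]; rewrite linearP /= (vpure_linl, vpure_linr).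
Qed.

Definition vassoc U W Z : 'Hom(vtens (vtens U W) Z, vtens U (vtens W Z)) :=
  vlift (fun t z => vlift (fun x y => vpure x (vpure y z)) t).

Definition vassoc_inv U W Z : 'Hom(vtens U (vtens W Z), vtens (vtens U W) Z) :=
  vlift (fun x t => vlift (fun y z => vpure (vpure x y) z) t).

Lemma vassocE U W Z (x : U) (y : W) (z : Z) :
  vassoc U W Z (vpure (vpure x y) z) = vpure x (vpure y z).
Proof.
rewrite vliftE; first rewrite vliftE //.
- by move=> y' a u v; rewrite vpure_linl.
- by move=> x' a u v; rewrite vpure_linl vpure_linr.
- by move=> z' a s t; rewrite linearP.
- by move=> t a u v; apply: vlift_param => x' y'; rewrite !vpure_linr.
Qed.

Lemma vassoc_invE U W Z (x : U) (y : W) (z : Z) :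
  vassoc_inv U W Z (vpure x (vpure y z)) = vpure (vpure x y) z.
Proof.
rewrite vliftE; first rewrite vliftE //.
- by move=> y' a u v; rewrite vpure_linr vpure_linl.
- by move=> x' a u v; rewrite vpure_linr.
- by move=> t a u v; apply: vlift_param => x' y'; rewrite !vpure_linl.
- by move=> z' a s t; rewrite linearP.
Qed.

Definition vlunit U : 'Hom(vtens C^o U, U) := vlift (fun (a : C^o) x => a *: x).
Definition vrunit U : 'Hom(vtens U C^o, U) := vlift (fun x (a : C^o) => a *: x).

Lemma vlunitE U (a : C^o) (x : U) : vlunit U (vpure a x) = a *: x.
Proof.
apply: vliftE => [y b u v|c b u v] /=; first by rewrite scalerDl scalerA.
by rewrite scalerDr !scalerA mulrC.
Qed.
Lemma vrunitE U (a : C^o) (x : U) : vrunit U (vpure x a) = a *: x.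
Proof.
apply: vliftE => [c b u v|y b u v] /=; last by rewrite scalerDl scalerA.
by rewrite scalerDr !scalerA mulrC.
Qed.
End VectTensor.

Set Primitive Projections.
Record rep (C : fieldType) (G : groupType) := Rep {
  rep_space :> vectType C;
  rep_act : G -> 'End(rep_space);
  rep_act1 : rep_act 1%g = \1%VF;
  rep_actM : forall g h, rep_act (g * h)%g = (rep_act g \o rep_act h)%VF
}.
Unset Primitive Projections.

Section RepCategory.
Variables (C : fieldType) (G : groupType).
Local Notation rep := (rep C G).

Definition intertwines (U W : rep) : {pred 'Hom(U, W)} :=
  fun f => `[< forall g x, f (rep_act U g x) = rep_act W g (f x) >].
Arguments intertwines : clear implicits.

Fact intertwines_submod (U W : rep) : submod_closed (intertwines U W).
Proof.
split=> [|a f f' /asboolP hf /asboolP hf']; apply/asboolP => g x.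
  by rewrite !lfunE /= linear0.
by rewrite !add_lfunE !scale_lfunE hf hf' linearP.
Qed.
HB.instance Definition _ (U W : rep) :=
  GRing.isSubmodClosed.Build C _ (intertwines U W) (intertwines_submod U W).

Record rhom (U W : rep) := RHom {
  rhom_map :> 'Hom(U, W); _ : rhom_map \in intertwines U W }.
HB.instance Definition _ U W := [isSub for @rhom_map U W].
HB.instance Definition _ U W := [Choice of rhom U W by <:].
HB.instance Definition _ U W := [SubChoice_isSubLmodule of rhom U W by <:].
End RepCategory.
Arguments intertwines {C G} U W.

Section RepTensorCat.
Variables (C : fieldType) (G : groupType).
Local Notation rep := (rep C G).
Implicit Types U W Z T : rep.

Lemma rhomP U W (f : rhom U W) g x : f (rep_act U g x) = rep_act W g (f x).
Proof. by have /asboolP := valP f. Qed.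

Lemma intertwinesP U W (f : 'Hom(U, W)) :
  (forall g x, f (rep_act U g x) = rep_act W g (f x)) -> f \in intertwines U W.
Proof. by move=> h; apply/asboolP. Qed.

Lemma intertwinesPf U W (f : 'Hom(U, W)) :
  (forall g, (f \o rep_act U g)%VF = (rep_act W g \o f)%VF) ->
  f \in intertwines U W.
Proof.
by move=> h; apply: intertwinesP => g x; have /lfunP/(_ x) := h g;
  rewrite !comp_lfunE.
Qed.

Lemma rhom_eq U W (f f' : rhom U W) : (forall x, f x = f' x) -> f = f'.
Proof. by move=> h; apply/val_inj/lfunP. Qed.

Lemma rhom_linE U W a (f f' : rhom U W) x : (a *: f + f') x = a *: f x + f' x.
Proof.
have -> : rhom_map (a *: f + f') = a *: rhom_map f + rhom_map f'.
  exact: (linearP (\val : rhom U W -> 'Hom(U, W))).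
by rewrite add_lfunE scale_lfunE.
Qed.

Fact rid_subproof U : \1%VF \in intertwines U U.
Proof. by apply: intertwinesP => g x; rewrite !id_lfunE. Qed.
Definition rid U : rhom U U := RHom (rid_subproof U).

Fact rcomp_subproof U W Z (f : rhom W Z) (g : rhom U W) :
  (f \o g)%VF \in intertwines U Z.
Proof. by apply: intertwinesP => a x; rewrite !comp_lfunE !rhomP. Qed.
Definition rcomp U W Z (f : rhom W Z) (g : rhom U W) : rhom U Z :=
  RHom (rcomp_subproof f g).

Lemma rcompE U W Z (f : rhom W Z) (g : rhom U W) x : rcomp f g x = f (g x).
Proof. exact: comp_lfunE. Qed.
Lemma ridE U x : rid U x = x.
Proof. exact: id_lfunE. Qed.

Fact rcompA U W Z T (h : rhom Z T) (g : rhom W Z) (f : rhom U W) :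
  rcomp h (rcomp g f) = rcomp (rcomp h g) f.
Proof. by apply: rhom_eq => x; rewrite !rcompE. Qed.
Fact rcomp1m U W (f : rhom U W) : rcomp (rid W) f = f.
Proof. by apply: rhom_eq => x; rewrite rcompE ridE. Qed.
Fact rcompm1 U W (f : rhom U W) : rcomp f (rid U) = f.
Proof. by apply: rhom_eq => x; rewrite rcompE ridE. Qed.
Fact rcomp_linl U W Z (f : rhom U W) : linear (fun g : rhom W Z => rcomp g f).
Proof. by move=> a g g'; apply: rhom_eq => x; rewrite !(rcompE, rhom_linE). Qed.
Fact rcomp_linr U W Z (g : rhom W Z) : linear (fun f : rhom U W => rcomp g f).
Proof.
by move=> a f f'; apply: rhom_eq => x; rewrite !(rcompE, rhom_linE) linearP.
Qed.

Definition RepCat : linCat C :=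
  @LinCat C rep (fun U W => rhom U W : lmodType C) rid rcomp
    rcompA rcomp1m rcompm1 rcomp_linl rcomp_linr.

(* g (x (x) y) = g x (x) g y *)
Definition rtens_act U W (g : G) : 'End(vtens U W) :=
  vtensm (rep_act U g) (rep_act W g).
Fact rtens_act1 U W : rtens_act U W 1%g = \1%VF.
Proof.
by apply: vtens_ext => x y; rewrite vtensmE !rep_act1 !id_lfunE.
Qed.
Fact rtens_actM U W g h :
  rtens_act U W (g * h)%g = (rtens_act U W g \o rtens_act U W h)%VF.
Proof.
by apply: vtens_ext => x y; rewrite comp_lfunE !vtensmE !rep_actM !comp_lfunE.
Qed.
Definition rtens U W : rep := Rep (rtens_act1 U W) (rtens_actM U W).

Lemma rtensE U W g x y :
  rep_act (rtens U W) g (vpure x y) = vpure (rep_act U g x) (rep_act W g y).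
Proof. exact: vtensmE. Qed.

(* the trivial representation *)
Fact runit_actM (g h : G) :
  \1%VF = (\1%VF \o \1%VF)%VF :> 'End(C^o : vectType C).
Proof. by rewrite comp_lfun1l. Qed.
Definition runit : rep := @Rep C G C^o (fun=> \1%VF) erefl runit_actM.

(* An equivariant map out of a tensor product can be tested on pure tensors. *)
Lemma intertwines_tens U W Z (f : 'Hom(vtens U W, Z)) :
  (forall g x y, f (vpure (rep_act U g x) (rep_act W g y)) =
                 rep_act Z g (f (vpure x y))) ->
  f \in intertwines (rtens U W) Z.
Proof.
move=> h; apply: intertwinesPf => g; apply: vtens_ext => x y.
by rewrite !comp_lfunE rtensE h.
Qed.

Fact rtensm_subproof U U' W W' (f : rhom U U') (g : rhom W W') :
  vtensm f g \in intertwines (rtens U W) (rtens U' W').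
Proof.
by apply: intertwines_tens => a x y; rewrite !(vtensmE, rtensE) !rhomP.
Qed.
Definition rtensm U U' W W' (f : rhom U U') (g : rhom W W') :
  rhom (rtens U W) (rtens U' W') := RHom (rtensm_subproof f g).

Fact rassoc_subproof U W Z :
  vassoc U W Z \in intertwines (rtens (rtens U W) Z) (rtens U (rtens W Z)).
Proof.
apply: intertwinesPf => g; apply: vtens3_extl => x y z.
by do 3!rewrite ?comp_lfunE /= ?/rtens_act ?(vtensmE, vassocE).
Qed.
Fact rassoc_inv_subproof U W Z :
  vassoc_inv U W Z \in intertwines (rtens U (rtens W Z)) (rtens (rtens U W) Z).
Proof.
apply: intertwinesPf => g; apply: vtens3_extr => x y z.
by do 3!rewrite ?comp_lfunE /= ?/rtens_act ?(vtensmE, vassoc_invE).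
Qed.
Fact rlunit_subproof U : vlunit U \in intertwines (rtens runit U) U.
Proof.
by apply: intertwines_tens => g a x; rewrite id_lfunE !vlunitE linearZ.
Qed.
Fact rrunit_subproof U : vrunit U \in intertwines (rtens U runit) U.
Proof.
by apply: intertwines_tens => g x a; rewrite id_lfunE !vrunitE linearZ.
Qed.
Definition rassoc U W Z : rhom (rtens (rtens U W) Z) (rtens U (rtens W Z)) :=
  RHom (rassoc_subproof U W Z).
Definition rassoc_inv U W Z : rhom (rtens U (rtens W Z)) (rtens (rtens U W) Z) :=
  RHom (rassoc_inv_subproof U W Z).
Definition rlunit U : rhom (rtens runit U) U := RHom (rlunit_subproof U).
Definition rrunit U : rhom (rtens U runit) U := RHom (rrunit_subproof U).

Lemma rtensmE U U' W W' (f : rhom U U') (g : rhom W W') x y :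
  rtensm f g (vpure x y) = vpure (f x) (g y).
Proof. exact: vtensmE. Qed.
Lemma rassocE U W Z (x : U) (y : W) (z : Z) :
  rassoc U W Z (vpure (vpure x y : rtens U W) z) = vpure x (vpure y z).
Proof. exact: vassocE. Qed.
Lemma rassoc_invE U W Z (x : U) (y : W) (z : Z) :
  rassoc_inv U W Z (vpure x (vpure y z : rtens W Z)) = vpure (vpure x y) z.
Proof. exact: vassoc_invE. Qed.
Lemma rlunitE U (a : C^o) (x : U) : rlunit U (vpure (a : runit) x) = a *: x.
Proof. exact: vlunitE. Qed.
Lemma rrunitE U (a : C^o) (x : U) : rrunit U (vpure x (a : runit)) = a *: x.
Proof. exact: vrunitE. Qed.

Lemma rhom_tens_eq U W Z (f f' : rhom (rtens U W) Z) :
  (forall (x : U) (y : W), f (vpure x y) = f' (vpure x y)) -> f = f'.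
Proof. by move=> h; apply/val_inj/vtens_ext. Qed.
Lemma rhom_tens3_eql U W Z T (f f' : rhom (rtens (rtens U W) Z) T) :
  (forall (x : U) (y : W) (z : Z), f (vpure (vpure x y : rtens U W) z) =
                                   f' (vpure (vpure x y : rtens U W) z)) ->
  f = f'.
Proof. by move=> h; apply/val_inj/vtens3_extl. Qed.
Lemma rhom_tens3_eqr U W Z T (f f' : rhom (rtens U (rtens W Z)) T) :
  (forall (x : U) (y : W) (z : Z), f (vpure x (vpure y z : rtens W Z)) =
                                   f' (vpure x (vpure y z : rtens W Z))) ->
  f = f'.
Proof. by move=> h; apply/val_inj/vtens3_extr. Qed.
Lemma rhom_tens4_eql U W Z T V (f f' : rhom (rtens (rtens (rtens U W) Z) T) V) :
  (forall (x : U) (y : W) (z : Z) (t : T),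
     f (vpure (vpure (vpure x y : rtens U W) z : rtens (rtens U W) Z) t) =
     f' (vpure (vpure (vpure x y : rtens U W) z : rtens (rtens U W) Z) t)) ->
  f = f'.
Proof. by move=> h; apply/val_inj/vtens4_extl. Qed.

Fact rtensm_id U W : rtensm (rid U) (rid W) = rid (rtens U W).
Proof. by apply: rhom_tens_eq => x y; rewrite rtensmE !ridE. Qed.
Fact rtensm_comp U U' U'' W W' W'' (f' : rhom U' U'') (f : rhom U U')
    (g' : rhom W' W'') (g : rhom W W') :
  rtensm (rcomp f' f) (rcomp g' g) = rcomp (rtensm f' g') (rtensm f g).
Proof. by apply: rhom_tens_eq => x y; rewrite rcompE !rtensmE !rcompE. Qed.
Fact rtensm_linl U U' W W' (g : rhom W W') :
  linear (fun f : rhom U U' => rtensm f g).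
Proof.
move=> a f f'; apply: rhom_tens_eq => x y.
by rewrite rhom_linE !rtensmE rhom_linE vpure_linl.
Qed.
Fact rtensm_linr U U' W W' (f : rhom U U') :
  linear (fun g : rhom W W' => rtensm f g).
Proof.
move=> a g g'; apply: rhom_tens_eq => x y.
by rewrite rhom_linE !rtensmE rhom_linE vpure_linr.
Qed.
Fact rassoc_iso U W Z : is_iso (rassoc U W Z : @hom C RepCat _ _).
Proof.
exists (rassoc_inv U W Z); split.
  by apply: rhom_tens3_eql => x y z; rewrite rcompE rassocE rassoc_invE ridE.
by apply: rhom_tens3_eqr => x y z; rewrite rcompE rassoc_invE rassocE ridE.
Qed.

Fact rlunit_inv_subproof U :
  linfun (vpure_r (1 : C^o)) \in intertwines U (rtens runit U).
Proof.
apply: intertwinesP => g x; rewrite !vpure_rE.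
by apply/esym/(etrans (@rtensE runit U g 1 x)); rewrite id_lfunE.
Qed.
Fact rrunit_inv_subproof U :
  linfun (vpure_l (1 : C^o)) \in intertwines U (rtens U runit).
Proof.
apply: intertwinesP => g x; rewrite !vpure_lE.
by apply/esym/(etrans (@rtensE U runit g x 1)); rewrite id_lfunE.
Qed.
Fact rlunit_iso U : is_iso (rlunit U : @hom C RepCat _ _).
Proof.
exists (RHom (rlunit_inv_subproof U)); split; last first.
  by apply: rhom_eq => x; rewrite rcompE vpure_rE rlunitE scale1r ridE.
apply: rhom_tens_eq => a x; rewrite rcompE rlunitE ridE vpure_rE.
by rewrite vpureZr [RHS]vpure_unitl.
Qed.
Fact rrunit_iso U : is_iso (rrunit U : @hom C RepCat _ _).
Proof.
exists (RHom (rrunit_inv_subproof U)); split; last first.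
  by apply: rhom_eq => x; rewrite rcompE vpure_lE rrunitE scale1r ridE.
apply: rhom_tens_eq => x a; rewrite rcompE rrunitE ridE vpure_lE.
by rewrite vpureZl [RHS]vpure_unitr.
Qed.

Fact rassoc_nat U U' W W' Z Z' (f : rhom U U') (g : rhom W W') (h : rhom Z Z') :
  rcomp (rassoc U' W' Z') (rtensm (rtensm f g) h) =
  rcomp (rtensm f (rtensm g h)) (rassoc U W Z).
Proof.
by apply: rhom_tens3_eql => x y z; rewrite !rcompE !(rtensmE, rassocE).
Qed.
Fact rlunit_nat U U' (f : rhom U U') :
  rcomp (rlunit U') (rtensm (rid runit) f) = rcomp f (rlunit U).
Proof.
by apply: rhom_tens_eq => a x; rewrite !rcompE rtensmE ridE !rlunitE linearZ.
Qed.
Fact rrunit_nat U U' (f : rhom U U') :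
  rcomp (rrunit U') (rtensm f (rid runit)) = rcomp f (rrunit U).
Proof.
by apply: rhom_tens_eq => x a; rewrite !rcompE rtensmE ridE !rrunitE linearZ.
Qed.
Fact rpentagon U W Z T :
  rcomp (rassoc U W (rtens Z T)) (rassoc (rtens U W) Z T) =
  rcomp (rtensm (rid U) (rassoc W Z T))
    (rcomp (rassoc U (rtens W Z) T) (rtensm (rassoc U W Z) (rid T))).
Proof.
apply: rhom_tens4_eql => x y z t.
by rewrite !rcompE !(rassocE, rtensmE, ridE).
Qed.
Fact rtriangle U W :
  rcomp (rtensm (rid U) (rlunit W)) (rassoc U runit W) =
  rtensm (rrunit U) (rid W).
Proof.
apply: rhom_tens3_eql => x a y.
rewrite rcompE rassocE !rtensmE !ridE rlunitE rrunitE.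
by rewrite vpureZl vpureZr.
Qed.

Definition Rep_tensorCat : tensorCat C :=
  @TensorCat C RepCat rtens rtensm runit rassoc rlunit rrunit
    rtensm_id rtensm_comp rtensm_linl rtensm_linr rassoc_iso rlunit_iso
    rrunit_iso rassoc_nat rlunit_nat rrunit_nat rpentagon rtriangle.
End RepTensorCat.

Section Functors.
Variables (C : numClosedFieldType) (A : finZmodType).
Local Notation V := (VA C A).
Local Notation ASp_ := (asp C A).
Local Notation Cliff_ := (cliff C A).
Implicit Types (v w : V) (T S : sp C A).

(* The grading of a representation of ASp(A), and the operators rho(T) *)
Definition asp_dual_act (U : rep C ASp_) (chi : dual C V) : 'End(U) :=
  rep_act U (asp_trans chi).
Definition asp_weight (U : rep C ASp_) v (xi : U) : Prop :=
  weight (asp_dual_act U) v xi.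
Definition asp_proj (U : rep C ASp_) v : 'End(U) := wproj (asp_dual_act U) v.
Definition rho (U : rep C ASp_) T : 'End(U) := rep_act U (ASp T 0).

Fact asp_dual_act0 U : asp_dual_act U 0 = \1%VF.
Proof. exact: rep_act1. Qed.
Fact asp_dual_actD U chi psi :
  asp_dual_act U (chi + psi) = (asp_dual_act U chi \o asp_dual_act U psi)%VF.
Proof. by rewrite /asp_dual_act asp_transD rep_actM. Qed.

Lemma asp_factor (g : ASp_) : g = (ASp (asp_sp g) 0 * asp_trans (asp_char g))%g.
Proof.
apply: asp_eqP => u; first by rewrite [RHS]spME sp1E.
by rewrite [RHS]asp_mul_char dual0E mul1r.
Qed.

Lemma asp_actE (U : rep C ASp_) (g : ASp_) v xi : asp_weight v xi ->
  rep_act U g xi = asp_char g v *: rho U (asp_sp g) xi.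
Proof.
by move=> h; rewrite {1}[g]asp_factor rep_actM comp_lfunE [rep_act U _ xi]h linearZ.
Qed.

Lemma rho1 U : rho U 1%g = \1%VF.
Proof. exact: rep_act1. Qed.
Lemma rhoM U T S : rho U (T * S)%g = (rho U T \o rho U S)%VF.
Proof.
rewrite /rho -rep_actM; congr rep_act; apply: asp_eqP => u //.
by rewrite [RHS]asp_mul_char !dual0E mulr1.
Qed.

Lemma rho_weight (U : rep C ASp_) T v (xi : U) :
  asp_weight v xi -> asp_weight (T v) (rho U T xi).
Proof.
move=> h chi; rewrite /asp_dual_act /rho -comp_lfunE -rep_actM.
rewrite [LHS](asp_actE _ h) [asp_char _ v]asp_mul_char dual0E mulr1.
by congr (_ *: rho U _ xi); apply: sp_eqP => u; rewrite [LHS]spME sp1E.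
Qed.

(* (T, lambda) xi = lambda(v) rho(T) xi for xi in U_v *)
Definition F_act (U : rep C ASp_) (c : Cliff_) : 'End(U) :=
  \sum_v ((cliff_lam c v *: rho U (cliff_sp c)) \o asp_proj U v)%VF.

Lemma F_actE (U : rep C ASp_) (c : Cliff_) v xi : asp_weight v xi ->
  F_act U c xi = cliff_lam c v *: rho U (cliff_sp c) xi.
Proof. by move=> h; rewrite /F_act (sum_wprojE _ h) scale_lfunE. Qed.

Lemma asp_ext (U : rep C ASp_) (W : vectType C) (f g : 'Hom(U, W)) :
  (forall v xi, asp_weight v xi -> f xi = g xi) -> f = g.
Proof. exact: weight_ext (asp_dual_act0 U) (asp_dual_actD U) _ _ _. Qed.

Fact F_act1 U : F_act U 1%g = \1%VF.
Proof.
apply: asp_ext => v xi h.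
by rewrite (F_actE _ h) cliff_lam1 cliff_sp1 rho1 scale1r.
Qed.
Fact F_actM U c d : F_act U (c * d)%g = (F_act U c \o F_act U d)%VF.
Proof.
apply: asp_ext => v xi h; rewrite comp_lfunE !(F_actE _ h) linearZ /=.
rewrite (F_actE _ (rho_weight _ h)) cliff_lamM cliff_spM rhoM comp_lfunE.
by rewrite scalerA mulrC.
Qed.
Definition F_obj (U : rep C ASp_) : rep C Cliff_ := Rep (F_act1 U) (F_actM U).

Lemma rhom_asp_weight (U W : rep C ASp_) (f : rhom U W) v xi :
  asp_weight v xi -> asp_weight v (f xi).
Proof.
by move=> h chi; rewrite /asp_dual_act -rhomP [rep_act _ _ _]h linearZ.
Qed.

Fact F_map_subproof (U W : rep C ASp_) (f : rhom U W) :
  rhom_map f \in intertwines (F_obj U) (F_obj W).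
Proof.
apply: intertwinesPf => c; apply: asp_ext => v xi h; rewrite !comp_lfunE /=.
rewrite (F_actE _ h) (F_actE _ (rhom_asp_weight _ h)) linearZ /=.
by congr (_ *: _); apply: rhomP.
Qed.
Definition F_map (U W : rep C ASp_) (f : rhom U W) : rhom (F_obj U) (F_obj W) :=
  RHom (F_map_subproof f).

Fact F_map_id U : F_map (rid U) = rid (F_obj U).
Proof. exact: rhom_eq. Qed.
Fact F_map_comp U W Z (g : rhom W Z) (f : rhom U W) :
  F_map (rcomp g f) = rcomp (F_map g) (F_map f).
Proof. exact: rhom_eq. Qed.
Fact F_map_lin U W : linear (@F_map U W).
Proof.
move=> a f g; apply: rhom_eq => x.
exact: etrans (rhom_linE a f g x) (esym (rhom_linE a (F_map f) (F_map g) x)).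
Qed.

Definition F_functor : functor (Rep_tensorCat C ASp_) (Rep_tensorCat C Cliff_) :=
  @Functor C (RepCat C ASp_) (RepCat C Cliff_) F_obj F_map
    F_map_id F_map_comp F_map_lin.

(* J (xi (x) eta) = beta(v, w) xi (x) eta for xi in U_v and eta in W_w *)
Definition Jmap (U W : rep C ASp_) :
    'Hom(rtens (F_obj U) (F_obj W), F_obj (rtens U W)) :=
  \sum_v \sum_w beta v w *: vtensm (asp_proj U v) (asp_proj W w).

Lemma JmapE (U W : rep C ASp_) v w (xi : U) (eta : W) :
  asp_weight v xi -> asp_weight w eta ->
  Jmap U W (vpure xi eta) = beta v w *: vpure xi eta.
Proof.
move=> hv hw; rewrite sum_lfunE (bigD1 v) //= [X in _ + X]big1 => [|v' /negPf v'v].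
  rewrite addr0 sum_lfunE (bigD1 w) //= [X in _ + X]big1 => [|w' /negPf w'w].
    rewrite addr0 scale_lfunE vtensmE (weight_wproj _ hv) (weight_wproj _ hw).
    by rewrite !eqxx.
  rewrite scale_lfunE vtensmE (weight_wproj _ hw) w'w.
  by rewrite -(scale0r eta) vpureZr scale0r scaler0.
rewrite sum_lfunE big1 // => w' _.
rewrite scale_lfunE vtensmE (weight_wproj _ hv) v'v.
by rewrite -(scale0r xi) vpureZl scale0r scaler0.
Qed.

(* The grading of a representation of C(A) *)
Definition cliff_dual_act (X : rep C Cliff_) (chi : dual C V) : 'End(X) :=
  rep_act X (cliff_trans chi).
Definition cliff_weight (X : rep C Cliff_) v (xi : X) : Prop :=
  weight (cliff_dual_act X) v xi.
Definition cliff_proj (X : rep C Cliff_) v : 'End(X) :=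
  wproj (cliff_dual_act X) v.

Fact cliff_dual_act0 X : cliff_dual_act X 0 = \1%VF.
Proof. by rewrite /cliff_dual_act cliff_trans0 rep_act1. Qed.
Fact cliff_dual_actD X chi psi :
  cliff_dual_act X (chi + psi) = (cliff_dual_act X chi \o cliff_dual_act X psi)%VF.
Proof. by rewrite /cliff_dual_act cliff_transD rep_actM. Qed.

Lemma cliff_ext (X : rep C Cliff_) (W : vectType C) (f g : 'Hom(X, W)) :
  (forall v xi, cliff_weight v xi -> f xi = g xi) -> f = g.
Proof. exact: weight_ext (cliff_dual_act0 X) (cliff_dual_actD X) _ _ _. Qed.

Lemma cliff_act_weight (X : rep C Cliff_) (c : Cliff_) v (xi : X) :
  cliff_weight v xi -> cliff_weight (cliff_sp c v) (rep_act X c xi).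
Proof.
move=> h chi; rewrite /cliff_dual_act -comp_lfunE -rep_actM.
have -> : (cliff_trans chi * c = c * cliff_trans (dual_comp chi (cliff_sp c)))%g.
  apply: cliff_eqP => u.
    by rewrite !cliff_spM !cliff_trans_sp mul1g mulg1.
  rewrite !cliff_lamM !cliff_trans_lam !cliff_trans_sp sp1E dual_compE.
  exact: mulrC.
by rewrite rep_actM comp_lfunE [rep_act X (cliff_trans _) xi]h linearZ dual_compE.
Qed.

(* Two lifts (T, lambda), (T, mu) of T satisfy
   lambda(v)^-1 (T, lambda) xi = mu(v)^-1 (T, mu) xi for xi in X_v. *)
Lemma cliff_lift_indep (X : rep C Cliff_) (c d : Cliff_) v (xi : X) :
  cliff_sp c = cliff_sp d -> cliff_weight v xi ->
  (cliff_lam c v)^-1 *: rep_act X c xi = (cliff_lam d v)^-1 *: rep_act X d xi.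
Proof.
move=> cd h; pose l u := cliff_lam c u / cliff_lam d u.
have chiP : is_char [ffun u => l u].
  apply: is_charP => [a b|a]; rewrite !ffunE /l; last first.
    by rewrite normrM normfV !cliff_lam_norm divr1.
  rewrite !cliff_lamD -mulf_div; have cdp : cliff_perm c = cliff_perm d.
    by have := congr1 (@sp_perm C A) cd.
  by rewrite cdp divff ?mulr1 ?mulf_div // mulf_neq0 ?invr_eq0 ?beta_neq0.
have -> : c = (d * cliff_trans (Dual chiP))%g.
  apply: cliff_eqP => u; first by rewrite cliff_spM cliff_trans_sp mulg1 cd.
  rewrite cliff_lamM cliff_trans_sp sp1E cliff_trans_lam ffunE /l.
  by rewrite mulrC divfK ?cliff_lam_neq0.
rewrite rep_actM comp_lfunE [rep_act X (cliff_trans _) xi]h linearZ scalerA.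
rewrite cliff_lamM cliff_trans_sp sp1E cliff_trans_lam invfM -mulrA mulVf ?mulr1 //.
exact: char_neq0.
Qed.

(* some lift of T to C(A) *)
Definition cliff_lift T : Cliff_ := sval (cid (cliff_sp_surj T)).
Lemma cliff_liftP T : cliff_sp (cliff_lift T) = T.
Proof. exact: svalP (cid (cliff_sp_surj T)). Qed.

Definition rhoX (X : rep C Cliff_) T : 'End(X) :=
  \sum_v (((cliff_lam (cliff_lift T) v)^-1 *: rep_act X (cliff_lift T))
           \o cliff_proj X v)%VF.

Lemma rhoXE (X : rep C Cliff_) (c : Cliff_) v xi : cliff_weight v xi ->
  rhoX X (cliff_sp c) xi = (cliff_lam c v)^-1 *: rep_act X c xi.
Proof.
move=> h; rewrite /rhoX (sum_wprojE _ h) scale_lfunE.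
by apply: cliff_lift_indep; rewrite ?cliff_liftP.
Qed.

Lemma rhoX_weight (X : rep C Cliff_) T v (xi : X) :
  cliff_weight v xi -> cliff_weight (T v) (rhoX X T xi).
Proof.
move=> h; rewrite -(cliff_liftP T) (rhoXE _ h); apply: weightZ.
exact: cliff_act_weight.
Qed.

Lemma rhoX1 X : rhoX X 1%g = \1%VF.
Proof.
apply: cliff_ext => v xi h.
by rewrite -cliff_sp1 (rhoXE _ h) cliff_lam1 invr1 scale1r rep_act1.
Qed.
Lemma rhoXM X T S : rhoX X (T * S)%g = (rhoX X T \o rhoX X S)%VF.
Proof.
rewrite -(cliff_liftP T) -(cliff_liftP S) -cliff_spM.
apply: cliff_ext => v xi h; rewrite comp_lfunE !(rhoXE _ h) linearZ /=.
rewrite (rhoXE _ (cliff_act_weight _ h)) rep_actM comp_lfunE cliff_lamM.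
by rewrite scalerA invfM mulrC.
Qed.

(* (T, chi) xi = chi(v) rho_X(T) xi for xi in X_v *)
Definition Finv_act (X : rep C Cliff_) (g : ASp_) : 'End(X) :=
  \sum_v ((asp_char g v *: rhoX X (asp_sp g)) \o cliff_proj X v)%VF.

Lemma Finv_actE (X : rep C Cliff_) (g : ASp_) v xi : cliff_weight v xi ->
  Finv_act X g xi = asp_char g v *: rhoX X (asp_sp g) xi.
Proof. by move=> h; rewrite /Finv_act (sum_wprojE _ h) scale_lfunE. Qed.

Fact Finv_act1 X : Finv_act X 1%g = \1%VF.
Proof.
apply: cliff_ext => v xi h.
by rewrite (Finv_actE _ h) rhoX1 [asp_char _ _]asp_one_char scale1r.
Qed.
Fact Finv_actM X g h : Finv_act X (g * h)%g = (Finv_act X g \o Finv_act X h)%VF.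
Proof.
apply: cliff_ext => v xi hv; rewrite comp_lfunE !(Finv_actE _ hv) linearZ /=.
rewrite (Finv_actE _ (rhoX_weight _ hv)) [asp_char (g * h)%g v]asp_mul_char rhoXM.
by rewrite comp_lfunE scalerA mulrC.
Qed.
Definition Finv_obj (X : rep C Cliff_) : rep C ASp_ :=
  Rep (Finv_act1 X) (Finv_actM X).

Lemma rhom_cliff_weight (X Y : rep C Cliff_) (f : rhom X Y) v xi :
  cliff_weight v xi -> cliff_weight v (f xi).
Proof.
by move=> h chi; rewrite /cliff_dual_act -rhomP [rep_act _ _ _]h linearZ.
Qed.

Fact Finv_map_subproof (X Y : rep C Cliff_) (f : rhom X Y) :
  rhom_map f \in intertwines (Finv_obj X) (Finv_obj Y).
Proof.
apply: intertwinesPf => g; apply: cliff_ext => v xi h; rewrite !comp_lfunE /=.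
rewrite (Finv_actE _ h) (Finv_actE _ (rhom_cliff_weight _ h)) linearZ /=.
congr (_ *: _); rewrite -(cliff_liftP (asp_sp g)).
by rewrite (rhoXE _ h) (rhoXE _ (rhom_cliff_weight _ h)) linearZ /= rhomP.
Qed.
Definition Finv_map (X Y : rep C Cliff_) (f : rhom X Y) :
  rhom (Finv_obj X) (Finv_obj Y) := RHom (Finv_map_subproof f).

Fact Finv_map_id X : Finv_map (rid X) = rid (Finv_obj X).
Proof. exact: rhom_eq. Qed.
Fact Finv_map_comp X Y Z (g : rhom Y Z) (f : rhom X Y) :
  Finv_map (rcomp g f) = rcomp (Finv_map g) (Finv_map f).
Proof. exact: rhom_eq. Qed.
Fact Finv_map_lin X Y : linear (@Finv_map X Y).
Proof.
move=> a f g; apply: rhom_eq => x.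
exact: etrans (rhom_linE a f g x) (esym (rhom_linE a (Finv_map f) (Finv_map g) x)).
Qed.

Definition Finv_functor :
    functor (Rep_tensorCat C Cliff_) (Rep_tensorCat C ASp_) :=
  @Functor C (RepCat C Cliff_) (RepCat C ASp_) Finv_obj Finv_map
    Finv_map_id Finv_map_comp Finv_map_lin.

(* K (xi (x) eta) = beta(v, w)^-1 xi (x) eta for xi in X_v and eta in Y_w *)
Definition Kmap (X Y : rep C Cliff_) :
    'Hom(rtens (Finv_obj X) (Finv_obj Y), Finv_obj (rtens X Y)) :=
  \sum_v \sum_w (beta v w)^-1 *: vtensm (cliff_proj X v) (cliff_proj Y w).

Lemma KmapE (X Y : rep C Cliff_) v w (xi : X) (eta : Y) :
  cliff_weight v xi -> cliff_weight w eta ->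
  Kmap X Y (vpure xi eta) = (beta v w)^-1 *: vpure xi eta.
Proof.
move=> hv hw; rewrite sum_lfunE (bigD1 v) //= [X in _ + X]big1 => [|v' /negPf v'v].
  rewrite addr0 sum_lfunE (bigD1 w) //= [X in _ + X]big1 => [|w' /negPf w'w].
    rewrite addr0 scale_lfunE vtensmE (weight_wproj _ hv) (weight_wproj _ hw).
    by rewrite !eqxx.
  rewrite scale_lfunE vtensmE (weight_wproj _ hw) w'w.
  by rewrite -(scale0r eta) vpureZr scale0r scaler0.
rewrite sum_lfunE big1 // => w' _.
rewrite scale_lfunE vtensmE (weight_wproj _ hv) v'v.
by rewrite -(scale0r xi) vpureZl scale0r scaler0.
Qed.
End Functors.

(* Main.v *)
From mathcomp Require Import all_boot all_order all_algebra all_fingroup.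
From mathcomp Require Import boolp reals complex.
Require Import Defs.

(** A representation of ASp(A) or of C(A) is graded by V_A through its
    translations (id, chi), and passing from one group to the other multiplies
    the action on the summand of degree v by a scalar: lambda(v) in one
    direction, lambda(v)^-1 in the other.  The two rescalings cancel, and they
    leave the translations, hence the grading, unchanged
    ([Finv_F_act], [F_Finv_act], [F_dual_act], [Finv_dual_act]).

    The rescaling is not multiplicative in the degree: lambda(v + w) is
    lambda(v) lambda(w) times beta(Tv, Tw) / beta(v, w).  So the identity map of a
    tensor product need not be equivariant for the new actions, but it becomes so
    once multiplied in bidegree (v, w) by beta(v, w), or by beta(v, w)^-1 in the
    other direction, because beta changes under T by exactly this quotient
    ([Jmap_intertwines], [Kmap_intertwines]).
    Everything else required of a tensor structure holds for multiplication by
    any nonvanishing bicharacter b of the grading group: associativity is the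
    cocycle identity b(u, v) b(u + v, w) = b(v, w) b(u, v + w), the unit laws are
    b(0, v) = b(v, 0) = 1 (the trivial representation has degree 0), and
    naturality holds because morphisms preserve degrees.  The single construction
    [twisted_structure] therefore yields both J, with b = beta, and K, with
    b = beta^-1.

    The two composites do not move the underlying spaces and maps, so they equal
    the identity tensor functor as soon as their actions, tensor structures and
    unit maps do ([tf_eq_id]); the tensor structures agree since the factors
    beta(v, w) and beta(v, w)^-1 cancel ([Jmap_Kmap], [Kmap_Jmap]). *)

Set Implicit Arguments.
Unset Strict Implicit.
Unset Printing Implicit Defensive.

Import GRing.Theory.
Local Open Scope ring_scope.

(** * Tensor products of graded spaces *)

Section Homogeneous.
Variables (C : numClosedFieldType) (V : finZmodType).

Section TensorExt.
Variables (U W : vectType C) (r : dual C V -> 'End(U)) (s : dual C V -> 'End(W)).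
Hypotheses (r0 : r 0 = \1%VF) (s0 : s 0 = \1%VF).
Hypothesis rD : forall chi psi, r (chi + psi) = (r chi \o r psi)%VF.
Hypothesis sD : forall chi psi, s (chi + psi) = (s chi \o s psi)%VF.

(** Homogeneous vectors span each factor, so a linear map out of a tensor product
    can be tested on pure tensors of homogeneous vectors. *)
Lemma vtens_weight_ext (Z : vectType C) (f g : 'Hom(vtens U W, Z)) :
  (forall v w x y, weight r v x -> weight s w y ->
     f (vpure x y) = g (vpure x y)) -> f = g.
Proof.
move=> fg; apply: vtens_ext => x y.
suff /lfunP/(_ x) : (f \o linfun (vpure_l y) = g \o linfun (vpure_l y))%VF.
  by rewrite !comp_lfunE !vpure_lE.
apply: (weight_ext r0 rD) => v x' hx; rewrite !comp_lfunE !vpure_lE.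
suff /lfunP/(_ y) : (f \o linfun (vpure_r x') = g \o linfun (vpure_r x'))%VF.
  by rewrite !comp_lfunE !vpure_rE.
apply: (weight_ext s0 sD) => w y' hy; rewrite !comp_lfunE !vpure_rE.
exact: (fg v w).
Qed.
End TensorExt.

Definition twist_map (b : V -> V -> C) (U W : vectType C)
    (r : dual C V -> 'End(U)) (s : dual C V -> 'End(W)) : 'End(vtens U W) :=
  \sum_v \sum_w b v w *: vtensm (wproj r v) (wproj s w).

Lemma twist_mapE b (U W : vectType C) (r : dual C V -> 'End(U))
    (s : dual C V -> 'End(W)) v w (x : U) (y : W) :
  weight r v x -> weight s w y ->
  twist_map b r s (vpure x y) = b v w *: vpure x y.
Proof.
move=> hx hy; rewrite /twist_map sum_lfunE (bigD1 v) //=.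
rewrite sum_lfunE (bigD1 w) //= scale_lfunE vtensmE.
rewrite (weight_wproj _ hx) (weight_wproj _ hy) !eqxx !big1 ?addr0 //.
  move=> v' /negPf v'v; rewrite sum_lfunE big1 // => w' _.
  rewrite scale_lfunE vtensmE (weight_wproj _ hx) v'v.
  by rewrite -(scale0r x) vpureZl scale0r scaler0.
move=> w' /negPf w'w; rewrite scale_lfunE vtensmE (weight_wproj _ hy) w'w.
by rewrite -(scale0r y) vpureZr scale0r scaler0.
Qed.
End Homogeneous.

(** Equivariance of the inverse is automatic, so for twisting by b only the linear
    identities between twisting by b and by b^-1 are left to check. *)
Lemma rhom_is_iso (C : fieldType) (G : groupType) (U W : rep C G)
    (f : rhom U W) (g : 'Hom(W, U)) :
  (g \o f)%VF = \1%VF -> (f \o g)%VF = \1%VF ->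
  is_iso (f : @hom C (RepCat C G) U W).
Proof.
move=> gf fg.
have gP : g \in intertwines W U.
  apply: intertwinesP => a y; have /lfunP/(_ y) := fg.
  rewrite comp_lfunE id_lfunE => {1}<-; rewrite -rhomP.
  by have /lfunP/(_ (rep_act U a (g y))) := gf; rewrite comp_lfunE id_lfunE.
by exists (RHom gP); split; apply: val_inj.
Qed.

(** * Tensor structures from bicharacters of the grading group *)

(** The functors considered here send a representation U of G to the same space
    with an action [act U] of H, and a morphism to the same linear map; the
    representations of G are graded by V through a homomorphism [t] from the dual
    of V. *)
Section TwistedTensorStructure.
Variables (C : numClosedFieldType) (V : finZmodType) (G H : groupType).

Variable t : dual C V -> G.
Hypotheses (t0 : t 0 = 1%g) (tD : forall chi psi, t (chi + psi) = (t chi * t psi)%g).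

Definition grading (U : rep C G) (chi : dual C V) : 'End(U) := rep_act U (t chi).

Lemma grading0 U : grading U 0 = \1%VF.
Proof. by rewrite /grading t0 rep_act1. Qed.
Lemma gradingD U chi psi :
  grading U (chi + psi) = (grading U chi \o grading U psi)%VF.
Proof. by rewrite /grading tD rep_actM. Qed.

Lemma weight_rhom (U W : rep C G) (f : rhom U W) v x :
  weight (grading U) v x -> weight (grading W) v (f x).
Proof. by move=> hx chi; rewrite /grading -rhomP [rep_act _ _ _]hx linearZ. Qed.

Lemma weight_vpure (U W : rep C G) v w (x : U) (y : W) :
  weight (grading U) v x -> weight (grading W) w y ->
  weight (grading (rtens U W)) (v + w) (vpure x y).
Proof.
move=> hx hy chi; rewrite /grading [LHS]rtensE.
by rewrite [rep_act U _ _]hx [rep_act W _ _]hy vpureZl vpureZr scalerA charD.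
Qed.

Lemma weight_runit (a : C^o) : weight (grading (runit C G)) 0 a.
Proof. by move=> chi; rewrite [LHS]id_lfunE char0 scale1r. Qed.

Variable act : forall U : rep C G, H -> 'End(U).
Hypothesis act1 : forall U, act U 1%g = \1%VF.
Hypothesis actM : forall U g h, act U (g * h)%g = (act U g \o act U h)%VF.
Let Fo (U : rep C G) : rep C H := Rep (act1 U) (actM U).
Variable fm : forall U W, rhom U W -> rhom (Fo U) (Fo W).
Hypothesis fmE : forall U W (f : rhom U W), rhom_map (fm f) = rhom_map f.
Hypothesis fm_id : forall U, fm (rid U) = rid (Fo U).
Hypothesis fm_comp : forall U W Z (g : rhom W Z) (f : rhom U W),
  fm (rcomp g f) = rcomp (fm g) (fm f).
Hypothesis fm_lin : forall U W, linear (@fm U W).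
Let F : functor (Rep_tensorCat C G) (Rep_tensorCat C H) :=
  @Functor C (RepCat C G) (RepCat C H) Fo fm fm_id fm_comp fm_lin.

Variable b : V -> V -> C.
Hypothesis b_neq0 : forall v w, b v w != 0.
Hypothesis bDl : forall u v w, b (u + v) w = b u w * b v w.
Hypothesis bDr : forall u v w, b u (v + w) = b u v * b u w.

Let tw U W := twist_map b (grading U) (grading W).
Hypothesis tw_intertwines : forall U W,
  tw U W \in intertwines (rtens (Fo U) (Fo W)) (Fo (rtens U W)).
Hypothesis act_runit : forall h, act (runit C G) h = \1%VF.

Let twJ U W : rhom (rtens (Fo U) (Fo W)) (Fo (rtens U W)) := RHom (tw_intertwines U W).

Fact twU_subproof : \1%VF \in intertwines (runit C H) (Fo (runit C G)).
Proof. by apply: intertwinesP => h x; rewrite /= act_runit. Qed.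
Let twU : rhom (runit C H) (Fo (runit C G)) := RHom twU_subproof.

Lemma bichar0l v : b 0 v = 1.
Proof. by apply: (mulfI (b_neq0 0 v)); rewrite -bDl addr0 mulr1. Qed.
Lemma bichar0r v : b v 0 = 1.
Proof. by apply: (mulfI (b_neq0 v 0)); rewrite -bDr addr0 mulr1. Qed.

Lemma graded_tens_ext (U W : rep C G) (Z : vectType C) (f g : 'Hom(vtens U W, Z)) :
  (forall v w x y, weight (grading U) v x -> weight (grading W) w y ->
     f (vpure x y) = g (vpure x y)) -> f = g.
Proof. exact: vtens_weight_ext (grading0 U) (grading0 W) (gradingD U) (gradingD W) _ _ _. Qed.

Lemma twJ_iso U W : is_iso (twJ U W : @hom C (RepCat C H) _ _).
Proof.
apply: (@rhom_is_iso C H _ _ (twJ U W)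
  (twist_map (fun v w => (b v w)^-1) (grading U) (grading W)));
  apply: graded_tens_ext => v w x y hx hy;
  rewrite comp_lfunE id_lfunE /= !(twist_mapE _ hx hy) linearZ /=
          (twist_mapE _ hx hy) scalerA ?divff ?mulVf ?scale1r //.
Qed.

Lemma twU_iso : is_iso (twU : @hom C (RepCat C H) _ _).
Proof. by apply: (@rhom_is_iso C H _ _ twU \1%VF); rewrite comp_lfun1l. Qed.

Lemma twJ_nat U U' W W' (f : rhom U U') (g : rhom W W') :
  rcomp (twJ U' W') (rtensm (fm f) (fm g)) = rcomp (fm (rtensm f g)) (twJ U W).
Proof.
apply/val_inj/graded_tens_ext => v w x y hx hy /=.
rewrite !comp_lfunE vtensmE !fmE (twist_mapE _ hx hy) linearZ /=.
rewrite rtensmE (twist_mapE b (weight_rhom _ hx) (weight_rhom _ hy)) //.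
Qed.

Lemma graded_tens3_ext (U W Z : rep C G) (T : vectType C)
    (f g : 'Hom(vtens (vtens U W) Z, T)) :
  (forall u v w x y z, weight (grading U) u x -> weight (grading W) v y ->
     weight (grading Z) w z ->
     f (vpure (vpure x y) z) = g (vpure (vpure x y) z)) -> f = g.
Proof.
move=> fg; apply: vtens_ext => p z.
suff /lfunP/(_ z) : (f \o linfun (vpure_r p) = g \o linfun (vpure_r p))%VF.
  by rewrite !comp_lfunE !vpure_rE.
apply: (weight_ext (grading0 Z) (gradingD Z)) => w z' hz.
rewrite !comp_lfunE !vpure_rE.
suff /lfunP/(_ p) : (f \o linfun (vpure_l z') = g \o linfun (vpure_l z'))%VF.
  by rewrite !comp_lfunE !vpure_lE.
apply: graded_tens_ext => u v x y hx hy; rewrite !comp_lfunE !vpure_lE.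
exact: (fg u v w).
Qed.

(** Both sides multiply a homogeneous x (x) y (x) z by b(u, v) b(u, w) b(v, w):
    expanding b(u + v, w) and b(u, v + w) gives the same three factors. *)
Lemma twJ_assoc U W Z :
  rcomp (fm (rassoc U W Z))
    (rcomp (twJ (rtens U W) Z) (rtensm (twJ U W) (rid (Fo Z)))) =
  rcomp (twJ U (rtens W Z))
    (rcomp (rtensm (rid (Fo U)) (twJ W Z)) (rassoc (Fo U) (Fo W) (Fo Z))).
Proof.
apply/val_inj/graded_tens3_ext => u v w x y z hx hy hz /=.
rewrite !comp_lfunE vassocE fmE !vtensmE !id_lfunE /=.
rewrite (twist_mapE b hx hy) (twist_mapE b hy hz) vpureZl vpureZr !linearZ /=.
rewrite (twist_mapE b (weight_vpure hx hy) hz).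
rewrite (twist_mapE b hx (weight_vpure hy hz)) linearZ /= vassocE !scalerA.
by rewrite bDl bDr mulrA mulrC.
Qed.

Lemma twJ_lunit U :
  rcomp (fm (rlunit U)) (rcomp (twJ (runit C G) U) (rtensm twU (rid (Fo U)))) =
  rlunit (Fo U).
Proof.
apply/val_inj/(@graded_tens_ext (runit C G) U) => v w a x _ hx /=.
rewrite !comp_lfunE fmE vtensmE !id_lfunE.
by rewrite (twist_mapE b (weight_runit a) hx) bichar0l scale1r.
Qed.

Lemma twJ_runit U :
  rcomp (fm (rrunit U)) (rcomp (twJ U (runit C G)) (rtensm (rid (Fo U)) twU)) =
  rrunit (Fo U).
Proof.
apply/val_inj/(@graded_tens_ext U (runit C G)) => v w x a hx _ /=.
rewrite !comp_lfunE fmE vtensmE !id_lfunE.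
by rewrite (twist_mapE b hx (weight_runit a)) bichar0r scale1r.
Qed.

Definition twisted_structure : tensorStructure F :=
  @TensorStructure C (Rep_tensorCat C G) (Rep_tensorCat C H) F twJ twU
    twJ_iso twU_iso twJ_nat twJ_assoc twJ_lunit twJ_runit.
End TwistedTensorStructure.

(** * Equality with the identity tensor functor *)

Section StrictIdentity.
Variables (C : fieldType) (G : groupType).

(** Equality of tensor functors involves types that depend on the values of the
    functor on objects.  Since the underlying space of [Rep (act1 U) (actM U)] is
    that of U by definition, no transport is needed to compare actions and maps
    with those of the identity functor; once [act U] is [rep_act U], the eta rule
    for [rep] makes this representation convertible to U, and only proofs of
    propositions remain to be identified. *)
Lemma tf_eq_id (act : forall U : rep C G, G -> 'End(U))
    (act1 : forall U, act U 1%g = \1%VF)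
    (actM : forall U g h, act U (g * h)%g = (act U g \o act U h)%VF)
    (fm : forall U W, rhom U W ->
            rhom (Rep (act1 U) (actM U)) (Rep (act1 W) (actM W)))
    (fm_id : forall U, fm U U (rid U) = rid (Rep (act1 U) (actM U)))
    (fm_comp : forall U W Z (g : rhom W Z) (f : rhom U W),
       fm U Z (rcomp g f) = rcomp (fm W Z g) (fm U W f))
    (fm_lin : forall U W, linear (fm U W))
    (J : @tensorStructure C (Rep_tensorCat C G) (Rep_tensorCat C G)
           (@Functor C (RepCat C G) (RepCat C G)
              (fun U => Rep (act1 U) (actM U)) fm fm_id fm_comp fm_lin)) :
    (forall U g, act U g = rep_act U g) ->
    (forall U W f, rhom_map (fm U W f) = rhom_map f) ->
    (forall U W : rep C G, rhom_map (tsJ J U W) = \1%VF) ->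
    rhom_map (tsU J) = \1%VF ->
  TensorFunctor J = tf_id (Rep_tensorCat C G).
Proof.
move=> actE.
have {}actE : act = fun U => @rep_act C G U.
  by apply: functional_extensionality_dep => U; apply/funext => g.
subst act.
have ? : act1 = @rep_act1 C G by exact: Prop_irrelevance.
have ? : actM = @rep_actM C G by exact: Prop_irrelevance.
subst act1 actM => fmE JE uE.
have ? : fm = fun U W f => f.
  apply: functional_extensionality_dep => U.
  apply: functional_extensionality_dep => W.
  by apply/funext => f; apply/val_inj/fmE.
subst fm.
have ? : fm_id = fun U => erefl by exact: Prop_irrelevance.
have ? : fm_comp = fun U W Z g f => erefl by exact: Prop_irrelevance.
have ? : fm_lin = fun U W a f g => erefl by exact: Prop_irrelevance.
subst fm_id fm_comp fm_lin.
congr (TensorFunctor _).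
case: J JE uE => J u J1 u1 Jn Ja Jl Jr /= JE uE.
have ? : J = fun U W => rid (rtens U W).
  apply: functional_extensionality_dep => U.
  by apply: functional_extensionality_dep => W; apply/val_inj/JE.
have ? : u = rid (runit C G) by exact/val_inj.
subst J u.
by congr TensorStructure; exact: Prop_irrelevance.
Qed.
End StrictIdentity.

(** * Affine symplectic and projective Clifford groups *)

Section Clifford.
Variables (C : numClosedFieldType) (A : finZmodType).
Local Notation V := (VA C A).
Local Notation ASp_ := (asp C A).
Local Notation Cliff_ := (cliff C A).

Lemma F_obj_actE (U : rep C ASp_) (c : Cliff_) v (x : U) : asp_weight v x ->
  rep_act (F_obj U) c x = cliff_lam c v *: rho U (cliff_sp c) x.
Proof. exact: F_actE. Qed.

Lemma Finv_obj_actE (X : rep C Cliff_) (g : ASp_) v (x : X) : cliff_weight v x ->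
  rep_act (Finv_obj X) g x = asp_char g v *: rhoX X (asp_sp g) x.
Proof. exact: Finv_actE. Qed.

(** The element (id, chi) of C(A) acts through its scalar part lambda = chi alone,
    which is how (id, chi) in ASp(A) acts, so the functor preserves the grading. *)
Lemma F_dual_act (U : rep C ASp_) chi :
  cliff_dual_act (F_obj U) chi = asp_dual_act U chi.
Proof.
apply: asp_ext => v x hx; rewrite [LHS](F_actE _ hx) [RHS]hx.
by rewrite cliff_trans_lam cliff_trans_sp rho1 id_lfunE.
Qed.

Lemma Finv_dual_act (X : rep C Cliff_) chi :
  asp_dual_act (Finv_obj X) chi = cliff_dual_act X chi.
Proof.
apply: cliff_ext => v x hx; rewrite [LHS](Finv_actE _ hx) [RHS]hx.
by rewrite rhoX1 id_lfunE.
Qed.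

Lemma F_weight (U : rep C ASp_) v (x : U) :
  asp_weight v x -> @cliff_weight C A (F_obj U) v x.
Proof. by move=> hx chi; rewrite F_dual_act hx. Qed.

Lemma Finv_weight (X : rep C Cliff_) v (x : X) :
  cliff_weight v x -> @asp_weight C A (Finv_obj X) v x.
Proof. by move=> hx chi; rewrite Finv_dual_act hx. Qed.

(** On the summand of degree v, any lift (T, lambda) of T acts on F(U) as
    lambda(v) rho(T), and the inverse functor divides by that same lambda(v). *)
Lemma Finv_F_act (U : rep C ASp_) g : Finv_act (F_obj U) g = rep_act U g.
Proof.
apply: asp_ext => v x hx; rewrite (Finv_actE _ (F_weight hx)) (asp_actE _ hx).
congr (_ *: _); rewrite -(cliff_liftP (asp_sp g)) (rhoXE _ (F_weight hx)).
by rewrite [rep_act _ _ _](F_actE _ hx) scalerA mulVf ?scale1r // cliff_lam_neq0.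
Qed.

Lemma F_Finv_act (X : rep C Cliff_) c : F_act (Finv_obj X) c = rep_act X c.
Proof.
apply: cliff_ext => v x hx; rewrite (F_actE _ (Finv_weight hx)).
have -> : rho (Finv_obj X) (cliff_sp c) x = rhoX X (cliff_sp c) x.
  by rewrite [LHS](Finv_actE _ hx) dual0E scale1r.
by rewrite (rhoXE _ hx) scalerA divff ?scale1r // cliff_lam_neq0.
Qed.

Lemma asp_weight_vpure (U W : rep C ASp_) v w (x : U) (y : W) :
  asp_weight v x -> asp_weight w y ->
  @asp_weight C A (rtens U W) (v + w) (vpure x y).
Proof. exact: weight_vpure. Qed.

Lemma cliff_weight_vpure (X Y : rep C Cliff_) v w (x : X) (y : Y) :
  cliff_weight v x -> cliff_weight w y ->
  @cliff_weight C A (rtens X Y) (v + w) (vpure x y).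
Proof. exact: weight_vpure. Qed.

Lemma asp_tens_ext (U W : rep C ASp_) (Z : vectType C) (f g : 'Hom(vtens U W, Z)) :
  (forall v w x y, asp_weight v x -> asp_weight w y ->
     f (vpure x y) = g (vpure x y)) -> f = g.
Proof.
exact: vtens_weight_ext (asp_dual_act0 U) (asp_dual_act0 W)
  (asp_dual_actD U) (asp_dual_actD W) _ _ _.
Qed.

Lemma cliff_tens_ext (X Y : rep C Cliff_) (Z : vectType C)
    (f g : 'Hom(vtens X Y, Z)) :
  (forall v w x y, cliff_weight v x -> cliff_weight w y ->
     f (vpure x y) = g (vpure x y)) -> f = g.
Proof.
exact: vtens_weight_ext (cliff_dual_act0 X) (cliff_dual_act0 Y)
  (cliff_dual_actD X) (cliff_dual_actD Y) _ _ _.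
Qed.

Lemma rho_vpure (U W : rep C ASp_) T (x : U) (y : W) :
  rho (rtens U W) T (vpure x y) = vpure (rho U T x) (rho W T y).
Proof. exact: rtensE. Qed.

(** On degrees v and w, acting before J gives lambda(v) lambda(w) beta(Tv, Tw) and
    acting after J gives lambda(v + w) beta(v, w): their equality is the defining
    relation of C(A). *)
Lemma Jmap_intertwines (U W : rep C ASp_) :
  Jmap U W \in intertwines (rtens (F_obj U) (F_obj W)) (F_obj (rtens U W)).
Proof.
apply: intertwinesPf => c; apply: asp_tens_ext => v w x y hx hy.
rewrite !comp_lfunE (JmapE hx hy) linearZ /=.
rewrite (F_actE _ (asp_weight_vpure hx hy)) rho_vpure.
rewrite [rtens_act (F_obj U) (F_obj W) c _]vtensmE.
rewrite (F_obj_actE _ hx) (F_obj_actE _ hy) vpureZl vpureZr !linearZ /=.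
rewrite (JmapE (rho_weight _ hx) (rho_weight _ hy)).
by rewrite !scalerA cliff_lamD -[X in _ = X *: _]mulrA divfK ?beta_neq0.
Qed.

(** Unlike rho for ASp(A), the operators rho_X(T) are not multiplicative on tensor
    products: a lift (T, lambda) acts diagonally, but lambda(v + w)^-1 need not be
    lambda(v)^-1 lambda(w)^-1.  The defect is what K repairs. *)
Lemma rhoX_vpure (X Y : rep C Cliff_) T v w (x : X) (y : Y) :
  cliff_weight v x -> cliff_weight w y ->
  rhoX (rtens X Y) T (vpure x y) =
  (beta v w / beta (T v) (T w)) *: vpure (rhoX X T x) (rhoX Y T y).
Proof.
move=> hx hy; rewrite -(cliff_liftP T) (rhoXE _ (cliff_weight_vpure hx hy)).
rewrite (rhoXE _ hx) (rhoXE _ hy) rtensE vpureZl vpureZr !scalerA cliff_lamD.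
congr (_ *: _).
by rewrite !invfM invrK [RHS]mulrC; congr (_ * _); apply: mulrC.
Qed.

Lemma Kmap_intertwines (X Y : rep C Cliff_) :
  Kmap X Y \in intertwines (rtens (Finv_obj X) (Finv_obj Y)) (Finv_obj (rtens X Y)).
Proof.
apply: intertwinesPf => g; apply: cliff_tens_ext => v w x y hx hy.
rewrite !comp_lfunE (KmapE hx hy) linearZ /=.
rewrite (Finv_actE _ (cliff_weight_vpure hx hy)) (rhoX_vpure _ hx hy).
rewrite [rtens_act (Finv_obj X) (Finv_obj Y) g _]vtensmE.
rewrite (Finv_obj_actE _ hx) (Finv_obj_actE _ hy) vpureZl vpureZr !linearZ /=.
rewrite (KmapE (rhoX_weight _ hx) (rhoX_weight _ hy)) !scalerA charD.
congr (_ *: _).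
by rewrite -[RHS]mulrA [X in _ = _ * X]mulrAC divff ?beta_neq0 // mul1r.
Qed.

(** The trivial representation has degree 0, and lambda(0) = 1. *)
Lemma F_act_runit (c : Cliff_) : F_act (runit C ASp_) c = \1%VF.
Proof.
apply/lfunP => a; have h := weight_runit (@asp_trans C A) a.
by rewrite (F_actE _ h) cliff_lam0 scale1r.
Qed.

Lemma Finv_act_runit (g : ASp_) : Finv_act (runit C Cliff_) g = \1%VF.
Proof.
apply/lfunP => a; have h := weight_runit (@cliff_trans C A) a.
rewrite (Finv_actE _ h) char0 scale1r -(cliff_liftP (asp_sp g)).
by rewrite (rhoXE _ h) cliff_lam0 invr1 scale1r.
Qed.

Definition F_tensor : tensorStructure (F_functor C A) :=
  @twisted_structure C V ASp_ Cliff_ (@asp_trans C A) (asp_trans0 C A)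
    (@asp_transD C A) (@F_act C A) (@F_act1 C A) (@F_actM C A) (@F_map C A)
    (fun U W f => erefl) (@F_map_id C A) (@F_map_comp C A) (@F_map_lin C A)
    (@beta C A) (@beta_neq0 C A) (@betaDl C A) (@betaDr C A)
    Jmap_intertwines F_act_runit.

Let betaV v w : C := (@beta C A v w)^-1.
Lemma betaV_neq0 v w : betaV v w != 0.
Proof. by rewrite invr_eq0 beta_neq0. Qed.
Lemma betaVDl u v w : betaV (u + v) w = betaV u w * betaV v w.
Proof. by rewrite /betaV betaDl invfM. Qed.
Lemma betaVDr u v w : betaV u (v + w) = betaV u v * betaV u w.
Proof. by rewrite /betaV betaDr invfM. Qed.

Definition Finv_tensor : tensorStructure (Finv_functor C A) :=
  @twisted_structure C V Cliff_ ASp_ (@cliff_trans C A) (@cliff_trans0 C A)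
    (@cliff_transD C A) (@Finv_act C A) (@Finv_act1 C A) (@Finv_actM C A)
    (@Finv_map C A) (fun U W f => erefl) (@Finv_map_id C A)
    (@Finv_map_comp C A) (@Finv_map_lin C A)
    betaV betaV_neq0 betaVDl betaVDr
    Kmap_intertwines Finv_act_runit.

Lemma Jmap_Kmap (U W : rep C ASp_) :
  (Jmap U W \o Kmap (F_obj U) (F_obj W))%VF = \1%VF.
Proof.
apply: (@asp_tens_ext U W) => v w x y hx hy; rewrite comp_lfunE id_lfunE.
rewrite (KmapE (F_weight hx) (F_weight hy)) linearZ /= (JmapE hx hy) scalerA.
by rewrite mulVf ?beta_neq0 // scale1r.
Qed.

Lemma Kmap_Jmap (X Y : rep C Cliff_) :
  (Kmap X Y \o Jmap (Finv_obj X) (Finv_obj Y))%VF = \1%VF.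
Proof.
apply: (@cliff_tens_ext X Y) => v w x y hx hy; rewrite comp_lfunE id_lfunE.
rewrite (JmapE (Finv_weight hx) (Finv_weight hy)) linearZ /= (KmapE hx hy).
by rewrite scalerA divff ?beta_neq0 // scale1r.
Qed.

Lemma Finv_F_id :
  tf_comp (TensorFunctor Finv_tensor) (TensorFunctor F_tensor) =
  tf_id (Rep_tensorCat C ASp_).
Proof.
apply: (@tf_eq_id C ASp_ (fun U => Finv_act (F_obj U)) (fun U => Finv_act1 (F_obj U))
  (fun U => Finv_actM (F_obj U)) (fun U W f => Finv_map (F_map f))) => //.
- exact: Finv_F_act.
- exact: Jmap_Kmap.
- exact: comp_lfun1l.
Qed.

Lemma F_Finv_id :
  tf_comp (TensorFunctor F_tensor) (TensorFunctor Finv_tensor) =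
  tf_id (Rep_tensorCat C Cliff_).
Proof.
apply: (@tf_eq_id C Cliff_ (fun X => F_act (Finv_obj X))
  (fun X => F_act1 (Finv_obj X)) (fun X => F_actM (Finv_obj X))
  (fun X Y f => F_map (Finv_map f))) => //.
- exact: F_Finv_act.
- exact: Kmap_Jmap.
- exact: comp_lfun1l.
Qed.
End Clifford.

Theorem theorem3p1 (R : realType) (A : finZmodType) :
  exists (J : tensorStructure (F_functor R[i] A))
         (K : tensorStructure (Finv_functor R[i] A)),
    let F := TensorFunctor J in
    let Finv := TensorFunctor K in
    [/\ (forall U W : rep R[i] (asp R[i] A), rhom_map (tsJ J U W) = Jmap U W),
        rhom_map (tsU J) = \1%VF,
        (forall X Y : rep R[i] (cliff R[i] A), rhom_map (tsJ K X Y) = Kmap X Y),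
        rhom_map (tsU K) = \1%VF &
        tf_isomorphism F /\ tf_inverse F Finv].
Proof.
exists (F_tensor R[i] A), (Finv_tensor R[i] A); split => //.
have inv : tf_inverse (TensorFunctor (F_tensor R[i] A))
                      (TensorFunctor (Finv_tensor R[i] A)).
  by split; [exact: Finv_F_id | exact: F_Finv_id].
by split => //; exists (TensorFunctor (Finv_tensor R[i] A)).
Qed.
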